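(* Let $j,r\ge 0$ and $k\ge 1$ be integers with $j+r\le k$. Define $P_j=q^{-2s_1}\prod_{i=2}^{j}(q^{2s_{i-1}}+q^{-2s_i})$ if $j\ge1$, and $P_0=1$. Then \[ \sum_{s_1\ge\cdots\ge s_k\ge 0}\frac{q^{2(s_1^2+\cdots+s_k^2+s_{k-r+1}+\cdots+s_k)}\,P_j\,(-q^{1+2s_k};q^2)_\infty}{(q^2;q^2)_{s_1-s_2}\cdots(q^2;q^2)_{s_{k-1}-s_k}(q^2;q^2)_{s_k}} =\frac{(-q^3;q^2)_\infty}{(q^2;q^2)_\infty}\sum_{s=0}^{j}\binom{j}{s}\Big((q^{4k+4},q^{2k+3-2r+2j-4s},q^{2k+1+2r-2j+4s};q^{4k+4})_\infty+q\,(q^{4k+4},q^{2k+1-2r+2j-4s},q^{2k+3+2r-2j+4s};q^{4k+4})_\infty\Big). \] Moreover, $P_j$ can be replaced by any product of $j$ factors taken from $\{q^{-2s_1}\}\cup\{(q^{2s_{i-1}}+q^{-2s_i}) : 2\le i\le k-r\}$, and the identity still holds.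
   Context: $q$ is a complex number with $|q|<1$. $(a;q)_\infty=\prod_{m\ge0}(1-aq^m)$, $(a;q)_n=(a;q)_\infty/(aq^n;q)_\infty$, $(a_1,\dots,a_m;q)_\infty=\prod_i(a_i;q)_\infty$. $s_{k-r+1}+\cdots+s_k$ denotes $\sum_{i=k-r+1}^k s_i$ (zero if $r=0$). $\binom{j}{s}$ is the ordinary binomial coefficient. *)

(* Defs.v *)
From mathcomp Require Import all_boot all_order all_algebra complex.
From mathcomp Require Import all_classical all_reals all_analysis summability.

Set Implicit Arguments.
Unset Strict Implicit.
Unset Printing Implicit Defensive.

Import Order.TTheory GRing.Theory Num.Theory.
Import numFieldNormedType.Exports.

Local Open Scope classical_set_scope.
Local Open Scope ring_scope.

Section Defs.
Variable K : numFieldType.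
Implicit Types a q P : K.

(* (a; q)_oo; the limit exists for |q| < 1 when K is complete, e.g. K = R[i]
   with R : realType. *)
Definition qpoch_inf a q : K :=
  lim ((fun n : nat => \prod_(m < n) (1 - a * q ^+ m)) @ \oo).

(* (a; q)_n *)
Definition qpoch a q (n : nat) : K := qpoch_inf a q / qpoch_inf (a * q ^+ n) q.

(* (a_1, ..., a_m; q)_oo *)
Definition qpochs_inf (s : seq K) q : K := \prod_(a <- s) qpoch_inf a q.

(* Unconditional (i.e. order-independent) convergence of \sum_i f i to l, along
   the finite subsets of I ordered by inclusion. In a finite-dimensional space
   such as the complex numbers this amounts to absolute convergence. *)
Definition sums_to (I : choiceType) (f : I -> K) (l : K) : Prop :=
  partial_sum f @ totally --> l.

(* Below, s : nat -> nat stands for (s_1, ..., s_k), numbered from 1. *)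
Implicit Type s : nat -> nat.

Definition P_ q (j : nat) s : K :=
  if j == 0%N then 1
  else q ^- (2 * s 1%N) *
       \prod_(2 <= i < j.+1) (q ^+ (2 * s i.-1) + q ^- (2 * s i)).

(* The factors allowed in place of those of P_j: q^(-2 s_1) has index 1, and
   q^(2 s_(i-1)) + q^(-2 s_i) has index i >= 2. *)
Definition P_factor q (i : nat) s : K :=
  if i == 1%N then q ^- (2 * s 1%N) else q ^+ (2 * s i.-1) + q ^- (2 * s i).

(* The summand of the left-hand side, with P in the place of P_j. *)
Definition lhs_term q (k r : nat) P s : K :=
  q ^+ (2 * (\sum_(1 <= i < k.+1) s i ^ 2 + \sum_(k - r + 1 <= i < k.+1) s i))
  * P * qpoch_inf (- q ^+ (1 + 2 * s k)) (q ^+ 2)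
  / ((\prod_(1 <= i < k) qpoch (q ^+ 2) (q ^+ 2) (s i - s i.+1))
     * qpoch (q ^+ 2) (q ^+ 2) (s k)).

(* The exponents are integers, so that no subtraction is truncated. *)
Definition rhs q (k r j : nat) : K :=
  qpoch_inf (- q ^+ 3) (q ^+ 2) / qpoch_inf (q ^+ 2) (q ^+ 2) *
  \sum_(0 <= s < j.+1) 'C(j, s)%:R *
    (qpochs_inf [:: q ^ (4 * k%:Z + 4);
                    q ^ (2 * k%:Z + 3 - 2 * r%:Z + 2 * j%:Z - 4 * s%:Z);
                    q ^ (2 * k%:Z + 1 + 2 * r%:Z - 2 * j%:Z + 4 * s%:Z)]
       (q ^+ (4 * k + 4))
     + q * qpochs_inf [:: q ^ (4 * k%:Z + 4);
                    q ^ (2 * k%:Z + 1 - 2 * r%:Z + 2 * j%:Z - 4 * s%:Z);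
                    q ^ (2 * k%:Z + 3 + 2 * r%:Z - 2 * j%:Z + 4 * s%:Z)]
       (q ^+ (4 * k + 4))).

End Defs.

(* The index set of the multiple sum: (s_1, ..., s_k) with s_1 >= ... >= s_k. *)
Notation decr_tuple k := {s : k.-tuple nat | sorted geq s}.

(* part t i is s_i for 1 <= i <= k (the default value of nth is not reached). *)
Definition part (k : nat) (t : decr_tuple k) (i : nat) : nat :=
  nth 0%N (val t) i.-1.

(* Main.v *)
(* Put x = -q and Q = q^2 = x^2. The summand depends on s_k through
   (x; Q)_oo / (x; x)_(2 s_k), and 1 / (x; x)_(2n) belongs to a Bailey pair
   relative to a = Q. Each of the r innermost summations, of weight
   Q^(s^2 + s) / (Q; Q)_(n-s), is a step of the Bailey lemma for a = Q. The pair
   so obtained is turned into one relative to a = 1 with the same beta, and each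
   of the k - r outer summations, of weight Q^(s^2) / (Q; Q)_(n-s), is a step for
   a = 1. There an additional factor Q^(s_(i-1)) + Q^(-s_i) merely multiplies
   alpha_l by Q^l + Q^(-l), for whichever i it is inserted: hence the freedom in
   the choice of the j factors, and the binomial coefficients on the right.
   Letting s_0 = n -> oo turns the factor of index 1 into Q^(-s_1) = q^(-2 s_1)
   and the sum over l into theta series, which the Jacobi triple product
   evaluates. As P_j is not defined for q = 0 < j, the case q = 0 only involves
   j = 0 and is trivial. *)
Require Import Defs.
From mathcomp Require Import all_boot all_order all_algebra complex finmap.
From mathcomp Require Import all_classical all_reals all_analysis summability.
From mathcomp Require Import ring lra zify.

Set Implicit Arguments.
Unset Strict Implicit.
Unset Printing Implicit Defensive.

Import Order.TTheory GRing.Theory Num.Theory.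
Import numFieldNormedType.Exports.

Local Open Scope ring_scope.

(** * Gaussian binomial coefficients *)

Section QSeries.
Variable F : fieldType.
Implicit Types (a c q t x : F) (n : nat).

Definition qprod a q n : F := \prod_(i < n) (1 - a * q ^+ i).

Lemma qprod0 a q : qprod a q 0 = 1.
Proof. exact: big_ord0. Qed.

Lemma qprodS a q n : qprod a q n.+1 = qprod a q n * (1 - a * q ^+ n).
Proof. exact: big_ord_recr. Qed.

Lemma qprodSl a q n : qprod a q n.+1 = (1 - a) * qprod (a * q) q n.
Proof.
rewrite /qprod big_ord_recl /= mulr1; congr (_ * _).
by apply: eq_bigr => i _; rewrite -mulrA -exprS.
Qed.

Lemma qprodD a q m n : qprod a q (m + n) = qprod a q m * qprod (a * q ^+ m) q n.
Proof.
elim: n => [|n IH]; first by rewrite addn0 qprod0 mulr1.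
by rewrite addnS !qprodS IH exprD !mulrA.
Qed.

Lemma qprod_double x n :
  qprod x x n.*2 = qprod x (x ^+ 2) n * qprod (x ^+ 2) (x ^+ 2) n.
Proof.
elim: n => [|n IH]; first by rewrite !qprod0 mulr1.
rewrite doubleS !qprodS IH -!exprM -!exprS -!exprD mul2n add2n; ring.
Qed.

(** The q-Pascal rule avoids division; the usual quotient of q-factorials is recovered in
    [qbinE]. *)
Fixpoint qbin q n i : F :=
  match n, i with
  | _, 0 => 1
  | 0, _.+1 => 0
  | n.+1, i.+1 => qbin q n i + q ^+ i.+1 * qbin q n i.+1
  end.

Lemma qbin0 q n : qbin q n 0 = 1. Proof. by case: n. Qed.

Lemma qbin_small q n i : (n < i)%N -> qbin q n i = 0.
Proof.
elim: n i => [|n IH] [|i] //= ltni.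
by rewrite !IH ?mulr0 ?addr0 // ltnW.
Qed.

(** The q-Pascal rule under a sum; it drives the inductions of [q_binomial], [q_vandermonde] and
    [gauss_sum]. *)
Lemma sum_qbinS q n (X : nat -> F) :
  \sum_(i < n.+2) qbin q n.+1 i * X i =
  \sum_(i < n.+1) qbin q n i * (q ^+ i * X i + X i.+1).
Proof.
rewrite big_ord_recl /= mul1r.
under eq_bigr do rewrite mulrDl.
rewrite big_split /= addrCA.
under [RHS]eq_bigr do rewrite mulrDr.
rewrite big_split /= addrC; congr (_ + _).
rewrite [RHS]big_ord_recl /= qbin0 expr0 !mul1r; congr (_ + _).
rewrite big_ord_recr /= qbin_small // mulr0 mul0r addr0.
by apply: eq_bigr => i _; rewrite mulrCA mulrA.
Qed.

Lemma qbinE q n i : (i <= n)%N ->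
  qbin q n i * (qprod q q i * qprod q q (n - i)) = qprod q q n.
Proof.
elim: n i => [|n IH] [|i] //=; rewrite ?qprod0 ?subn0 ?mul1r //.
rewrite ltnS subSS => le_in.
rewrite mulrDl qprodS [RHS]qprodS -!exprS.
have -> : qbin q n i * (qprod q q i * (1 - q ^+ i.+1) * qprod q q (n - i)) =
   qprod q q n * (1 - q ^+ i.+1) by rewrite -(IH i) //; ring.
case: (ltngtP i n) le_in => // [lt_in|->] _; last first.
  by rewrite qbin_small // mulr0 mul0r addr0.
rewrite -[(n - i)%N]prednK ?subn_gt0 // -subnS qprodS -!exprS subnSK //.
have -> : q ^+ n.+1 = q ^+ i.+1 * q ^+ (n - i) by rewrite -exprD addSn subnKC // ltnW.
have := IH i.+1 lt_in; rewrite qprodS -exprS.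
set a := qbin _ _ _; set b := qprod _ _ _; set d := qprod _ _ _ => <-; ring.
Qed.

Lemma q_binomial q t n :
  \sum_(i < n.+1) qbin q n i * (q ^+ 'C(i, 2) * t ^+ i) =
  \prod_(i < n) (1 + t * q ^+ i).
Proof.
elim: n t => [|n IH] t; first by rewrite big_ord_recl !big_ord0 /= !mulr1 addr0.
rewrite (sum_qbinS q n (fun i => q ^+ 'C(i, 2) * t ^+ i)) big_ord_recl /= mulr1.
have -> : \prod_(i < n) (1 + t * q ^+ bump 0 i) = \prod_(i < n) (1 + t * q * q ^+ i).
  by apply: eq_bigr => i _; rewrite exprS mulrA.
rewrite -IH mulr_sumr; apply: eq_bigr => i _.
rewrite binS bin1 exprD exprS exprMn; ring.
Qed.

(* q-Chu-Vandermonde, with one numerator parameter sent to infinity *)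
Lemma q_vandermonde q c n : (forall m, 1 - c * q ^+ m != 0) ->
  \sum_(i < n.+1) qbin q n i * (q ^+ (i * i.-1) * c ^+ i / qprod c q i) =
  (qprod c q n)^-1.
Proof.
elim: n c => [|n IH] c c0.
  by rewrite big_ord_recl big_ord0 /= qprod0 invr1 !mulr1 addr0.
rewrite (sum_qbinS q n (fun i => q ^+ (i * i.-1) * c ^+ i / qprod c q i)).
have d0 m : 1 - c * q * q ^+ m != 0 by rewrite -mulrA -exprS.
have c1 : 1 - c != 0 by have := c0 0; rewrite mulr1.
(* Term by term, the sum for c at n + 1 is 1 / (1 - c) times the sum for c q at n. *)
rewrite qprodSl invfM -(IH (c * q)) // mulr_sumr; apply: eq_bigr => i _.
have e : qprod c q i / (1 - c) * (1 - c * q ^+ i) = qprod (c * q) q i.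
  by rewrite mulrAC -qprodS qprodSl; field.
have p0 : qprod (c * q) q i != 0.
  by apply/prodf_neq0 => m _.
have p1 : qprod c q i != 0.
  by apply/prodf_neq0 => m _.
rewrite qprodSl /=.
have -> : q ^+ (i.+1 * i) = q ^+ (i * i.-1) * q ^+ i * q ^+ i.
  rewrite -!exprD; congr (_ ^+ _); case: (nat_of_ord i) => //= m; lia.
rewrite -e exprS exprMn.
field.
by rewrite c0 p1 c1.
Qed.

(** The q-analogue of (i + 1) C(n + 1, i + 1) = (n + 1) C(n, i), read off from the quotient form. *)
Lemma qbinSl q n i : (forall m, 1 - q ^+ m.+1 != 0) ->
  (1 - q ^+ i.+1) * qbin q n.+1 i.+1 = (1 - q ^+ n.+1) * qbin q n i.
Proof.
move=> q0; have p0 m : qprod q q m != 0.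
  by apply/prodf_neq0 => ? _; rewrite -exprS.
case: (leqP i n) => [le_in|lt_ni]; last by rewrite !qbin_small ?mulr0.
apply: (mulIf (p0 i)); apply: (mulIf (p0 (n - i)%N)).
rewrite -[RHS]mulrA -[X in _ = X]mulrA qbinE //.
have := @qbinE q n.+1 i.+1 le_in; rewrite subSS !qprodS -!exprS => e.
rewrite [RHS]mulrC -e; ring.
Qed.

(** The left side is a Rogers-Szego polynomial of base x^2 at the point x. The Pascal and absorption
    rules give it a recurrence of order two in n, which the product satisfies as well. *)
Lemma gauss_sum x n : (forall m, 1 - x ^+ m.+1 != 0) ->
  \sum_(i < n.+1) qbin (x ^+ 2) n i * x ^+ i = \prod_(i < n) (1 + x ^+ i.+1).
Proof.
move=> x0; have q0 m : 1 - (x ^+ 2) ^+ m.+1 != 0.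
  by rewrite -exprM mul2n doubleS.
pose H n := \sum_(i < n.+1) qbin (x ^+ 2) n i * x ^+ i.
have H0 : H 0 = 1 by rewrite /H big_ord_recl big_ord0 /= mulr1 addr0.
have H1 : H 1%N = 1 + x.
  by rewrite /H !big_ord_recl big_ord0 /= /bump /=; ring.
have rec m : H m.+2 = (1 + x) * H m.+1 - (1 - x ^+ m.+1 ^+ 2) * x * H m.
  rewrite {1}/H (sum_qbinS _ m.+1 (fun i => x ^+ i)).
  suff : \sum_(i < m.+2) qbin (x ^+ 2) m.+1 i * ((1 - (x ^+ 2) ^+ i) * x ^+ i) =
     (1 - x ^+ m.+1 ^+ 2) * x * H m.
    move=> <-; rewrite /H mulr_sumr -sumrB; apply: eq_bigr => i _.
    rewrite (exprS x i); ring.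
  rewrite big_ord_recl /= subrr mul0r mulr0 add0r mulr_sumr.
  apply: eq_bigr => i _; rewrite /bump /= add1n -/(qbin _ m.+1 i.+1).
  rewrite mulrA [qbin _ _ _ * _]mulrC qbinSl // -!exprM mulnC (exprS x i); ring.
suff : H n = \prod_(i < n) (1 + x ^+ i.+1) /\
       H n.+1 = \prod_(i < n.+1) (1 + x ^+ i.+1) by case.
elim: n => [|n [IH1 IH2]].
  by rewrite H0 H1 big_ord0 big_ord_recl big_ord0 mulr1.
split=> //; rewrite rec IH1 IH2 !big_ord_recr /= (exprS x n.+1); ring.
Qed.

Lemma big_fold n (f : nat -> F) :
  \sum_(i < n.*2.+1) f i =
  f n + \sum_(l < n) (f (n - l.+1)%N + f (n + l.+1)%N).
Proof.
rewrite -(big_mkord xpredT f) (@big_cat_nat _ _ _ n) //=; last by lia.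
rewrite (@big_nat_recl _ _ _ _ n) //=; last by lia.
rewrite addrCA; congr (_ + _); rewrite big_split /=; congr (_ + _).
  by rewrite big_mkord -[RHS](big_mkord xpredT (fun l => f (n - l.+1)%N))
     -(big_mkord xpredT f) big_nat_rev /= add0n.
rewrite -{1}[n]add0n -addnn big_addn addnK big_mkord.
by apply: eq_bigr => i _; congr f; lia.
Qed.

End QSeries.

(** * Bailey pairs *)

Section BaileyPairs.
Variables (F : fieldType) (q : F).
Hypothesis q1 : forall m, 1 - q ^+ m.+1 != 0.
Implicit Types (a n l : nat) (alpha beta gamma : nat -> F).

Local Notation qf := (qprod q q).

Lemma qf_neq0 n : qf n != 0.
Proof. by apply/prodf_neq0 => i _; rewrite -exprS. Qed.
Local Hint Resolve qf_neq0 : core.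

Definition bailey_ker a n l : F := (qf (n - l) * qf (n + l + a))^-1.

(* A Bailey pair relative to q^a in the classical sense, except that the usual
   denominator (q^(a+1); q)_(n+l) is replaced by (q; q)_(n+l+a). *)
Definition bailey_pair a alpha beta :=
  forall n, beta n = \sum_(l < n.+1) alpha l * bailey_ker a n l.

(** This is [q_vandermonde] at c = q^(m+1), divided by (q; q)_n (q; q)_m. *)
Lemma q_vandermonde_shift n m :
  \sum_(i < n.+1) q ^+ (i * (i + m)) / (qf (n - i) * qf i * qf (i + m)) =
  (qf n * qf (n + m))^-1.
Proof.
have c0 i : 1 - q * q ^+ m * q ^+ i != 0 by rewrite -mulrA -exprD -exprS.
rewrite [(n + m)%N]addnC qprodD mulrA invfM -(q_vandermonde _ c0) mulr_sumr.
apply: eq_bigr => i _.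
rewrite [(i + m)%N]addnC qprodD.
have p0 : qprod (q * q ^+ m) q i != 0 by apply/prodf_neq0.
have := qbinE q (n := n) (i := i) (ltn_ord i) => <-.
have -> : q ^+ (i * (m + i)) = q ^+ (i * i.-1) * (q * q ^+ m) ^+ i.
  by rewrite -exprS -exprM -exprD; congr (_ ^+ _); case: (nat_of_ord i) => [|j] /=; nia.
have b0 : qbin q n i != 0.
  have := qf_neq0 n; rewrite -(qbinE q (n := n) (i := i) (ltn_ord i)).
  by rewrite mulf_eq0 negb_or => /andP[].
by field; rewrite p0 b0 !qf_neq0.
Qed.

(** The Bailey lemma with both free parameters sent to infinity, at the level of kernels. Shifting s
    by l gives [q_vandermonde_shift] for n - l and m = 2 l + a. *)
Lemma bailey_step a n l : (l <= n)%N ->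
  \sum_(l <= s < n.+1) q ^+ (s * (s + a)) / qf (n - s) * bailey_ker a s l =
  q ^+ (l * (l + a)) * bailey_ker a n l.
Proof.
move=> le_ln; rewrite -{1}[l]add0n big_addn big_mkord subSn //.
have -> : bailey_ker a n l = (qf (n - l) * qf (n - l + (l.*2 + a)))^-1.
  by rewrite /bailey_ker; congr (_ * qf _)^-1; lia.
rewrite -q_vandermonde_shift mulr_sumr; apply: eq_bigr => i _.
rewrite /bailey_ker addnK [(i + l + l + a)%N](_ : _ = i + (l.*2 + a))%N; last by lia.
rewrite [(n - (i + l))%N](_ : _ = n - l - i)%N; last by lia.
rewrite [((i + l) * (i + l + a))%N](_ : _ = l * (l + a) + i * (i + (l.*2 + a)))%N; last by nia.
by rewrite exprD; field; rewrite !qf_neq0.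
Qed.

(** An exchange of the sums over s and l. The weights g and w stay abstract to cover both
    [bailey_step] and [bailey_step_factor]. *)
Lemma bailey_pair_step a alpha beta (g : nat -> nat -> F) (w : nat -> F) :
  (forall n l, (l <= n)%N ->
     \sum_(l <= s < n.+1) g n s * bailey_ker a s l = w l * bailey_ker a n l) ->
  bailey_pair a alpha beta ->
  bailey_pair a (fun l => w l * alpha l) (fun n => \sum_(s < n.+1) g n s * beta s).
Proof.
move=> step pair n; under eq_bigr do rewrite pair mulr_sumr.
under eq_bigr => s _.
  rewrite (big_ord_widen n.+1 (fun l => g n s * (alpha l * bailey_ker a s l))) //.
  over.
rewrite (exchange_big_dep xpredT) //=; apply: eq_bigr => l _.
rewrite mulrAC -step -1?ltnS // mulr_suml.
rewrite (big_nat_widenl _ 0) // big_mkord; apply: eq_big => [s|s _]; first by rewrite ltnS.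
by rewrite -mulrA [alpha _ * _]mulrC.
Qed.

(* Write 1 - q^(2l+1) = (1 - q^(n+l+1)) - q^(2l+1) (1 - q^(n-l)). *)
Lemma bailey_pair_1to0 gamma beta :
  bailey_pair 1 (fun l => gamma l * (1 - q ^+ l.*2.+1)) beta ->
  bailey_pair 0
    (fun l => gamma l - (if l is m.+1 then q ^+ m.*2.+1 * gamma m else 0)) beta.
Proof.
move=> pair n; rewrite pair.
under [RHS]eq_bigr do rewrite mulrBl.
rewrite sumrB [X in _ = _ - X]big_ord_recl /= mul0r add0r.
rewrite big_ord_recr [X in _ = X - _]big_ord_recr /= [RHS]addrAC -sumrB.
congr (_ + _); last first.
  rewrite /bailey_ker addnn addn0 addn1 subnn qprodS -exprS.
  by field; rewrite !qf_neq0 q1.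
apply: eq_bigr => l _; rewrite /bump /= add1n /bailey_ker.
have ln : (n - l = (n - l.+1).+1)%N by have := ltn_ord l; lia.
rewrite ln !addn0 addn1 addnS !qprodS -!exprS -ln.
have e : q ^+ (n + l).+1 = q ^+ (n - l) * q ^+ l.*2.+1.
  by rewrite -exprD; congr (_ ^+ _); have := ltn_ord l; lia.
have d1 : 1 - q ^+ (n - l) != 0 by rewrite ln.
have d2 := q1 (n + l); rewrite e in d2 *.
by field; rewrite !qf_neq0 d1 d2.
Qed.

(** The q-binomials of 2 n at n - l and n + l both equal (q; q)_(2n) times the kernel for a = 0. So
    a sum of q-binomials in closed form yields a Bailey pair; this is applied to Gauss's sum and to
    the q-binomial theorem. *)
Lemma sum_qbin_fold n (h : nat -> F) :
  \sum_(i < n.*2.+1) qbin q n.*2 i * h i =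
  qf n.*2 * \sum_(l < n.+1)
    (if l == 0%N :> nat then h n else h (n - l)%N + h (n + l)%N) * bailey_ker 0 n l.
Proof.
have qbE i : (i <= n.*2)%N -> qbin q n.*2 i = qf n.*2 * (qf i * qf (n.*2 - i))^-1.
  by move=> /(qbinE q) <-; rewrite mulfK // mulf_neq0.
rewrite (big_fold n (fun i => qbin q n.*2 i * h i)) big_ord_recl mulrDr mulr_sumr /=; congr (_ + _).
  rewrite qbE ?/bailey_ker; last by lia.
  by rewrite -addnn addnK !addn0 subn0; ring.
apply: eq_bigr => l _; have := ltn_ord l => ln; rewrite /bump /= add1n.
rewrite !qbE; try by lia.
rewrite /bailey_ker (_ : n.*2 - (n - l.+1) = n + l.+1)%N; last by lia.
rewrite addn0 (_ : n.*2 - (n + l.+1) = n - l.+1)%N; last by lia.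
by field; rewrite !qf_neq0.
Qed.

Hypothesis q0 : q != 0.

(* For a = 0, inserting q^n + q^(-s) in the summand only multiplies the result
   by q^l + q^(-l): write q^(-s) = q^(-s) (1 - q^(s-l)) + q^(-l), and sum the
   first part by the q-Chu-Vandermonde formula. *)
Lemma bailey_step_factor n l : (l <= n)%N ->
  \sum_(l <= s < n.+1)
     q ^+ (s * s) * (q ^+ n + q ^- s) / qf (n - s) * bailey_ker 0 s l =
  q ^+ (l * l) * (q ^+ l + q ^- l) * bailey_ker 0 n l.
Proof.
move=> le_ln; have q0' m : q ^+ m != 0 by rewrite expf_neq0.
have step := bailey_step 0 le_ln; rewrite addn0 in step.
transitivity ((q ^+ n + q ^- l) * (q ^+ (l * l) * bailey_ker 0 n l)
  + \sum_(l <= s < n.+1)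
     q ^+ (s * s) * q ^- s * (1 - q ^+ (s - l)) / qf (n - s) * bailey_ker 0 s l).
  rewrite -step mulr_sumr -big_split /= !big_nat; apply: eq_bigr => s /andP[ls _].
  rewrite addn0.
  have e : q ^+ s = q ^+ (s - l) * q ^+ l by rewrite -exprD subnK.
  by rewrite e; field; rewrite !q0' qf_neq0.
(* The factor 1 - q^(s-l) kills the term s = l. Shifted by l + 1, the rest is [q_vandermonde_shift]
   for n - l - 1 and m = 2 l + 1, whose value is [k] below. *)
rewrite big_ltn // subnn subrr mulr0 !mul0r add0r.
case: (ltngtP l n) le_ln => // [lt_ln|->] _; last first.
  by rewrite big_geq //; field; rewrite q0'.
pose k := (qf (n - l.+1) * qf (n - l.+1 + l.*2.+1))^-1.
have d0 : 1 - q ^+ (n - l) != 0 by rewrite -[(n - l)%N]prednK ?subn_gt0.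
have -> : bailey_ker 0 n l = k / (1 - q ^+ (n - l)).
  rewrite /k /bailey_ker addn0 (_ : n - l.+1 + l.*2.+1 = n + l)%N; last by lia.
  rewrite -[(n - l)%N]prednK ?subn_gt0 // -subnS qprodS -exprS.
  by field; rewrite !qf_neq0 q1.
rewrite -{1}[l.+1]add0n big_addn big_mkord subSn //.
have -> : \sum_(i < (n - l.+1).+1)
     q ^+ ((i + l.+1) * (i + l.+1)) * q ^- (i + l.+1) * (1 - q ^+ (i + l.+1 - l)) /
       qf (n - (i + l.+1)) * bailey_ker 0 (i + l.+1) l = q ^+ (l * l) * q ^+ l * k.
  rewrite /k -q_vandermonde_shift mulr_sumr; apply: eq_bigr => i _.
  rewrite (_ : i + l.+1 - l = i.+1)%N; last by lia.
  rewrite /bailey_ker (_ : i + l.+1 - l = i.+1)%N; last by lia.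
  rewrite (_ : i + l.+1 + l + 0 = i + l.*2.+1)%N; last by lia.
  rewrite (_ : n - (i + l.+1) = n - l.+1 - i)%N; last by lia.
  rewrite (_ : (i + l.+1) * (i + l.+1) =
    l * l + l + i * (i + l.*2.+1) + (i + l.+1))%N; last by nia.
  by rewrite qprodS -exprS !exprD; field; rewrite !qf_neq0 q1 !q0'.
have -> : q ^+ n = q ^+ (n - l) * q ^+ l by rewrite -exprD subnK // ltnW.
by field; rewrite q0' d0.
Qed.

End BaileyPairs.

(** * The initial Bailey pair *)

Section InitialPair.
Variables (F : fieldType) (x : F).
Hypothesis x1 : forall m, 1 - x ^+ m.+1 != 0.
Hypothesis x0 : x != 0.

Local Notation q := (x ^+ 2).

Let q1 m : 1 - q ^+ m.+1 != 0.
Proof. by rewrite -exprM mul2n doubleS. Qed.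

Let x0' m : x ^+ m != 0. Proof. by rewrite expf_neq0. Qed.

Let xf0 m : qprod x x m != 0.
Proof. by apply/prodf_neq0 => i _; rewrite -exprS. Qed.

Lemma qprod_sqr n : qprod q q n = qprod x x n * \prod_(i < n) (1 + x ^+ i.+1).
Proof.
rewrite /qprod -big_split /=; apply: eq_bigr => i _.
by rewrite -!exprS -exprM mul2n -addnn exprD; ring.
Qed.

(** [gauss_sum] for 2 n, folded around the index n and divided by x^n (q; q)_(2n). *)
Lemma gauss_pair :
  bailey_pair q 0 (fun l => if l == 0%N then 1 else x ^+ l + x ^- l)
    (fun n => x ^- n / qprod x x n.*2).
Proof.
move=> n; have := sum_qbin_fold q1 n (fun i => x ^+ i).
rewrite gauss_sum // => e.
have e2 : \sum_(l < n.+1) (if l == 0%N :> nat then x ^+ n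
      else x ^+ (n - l) + x ^+ (n + l)) * bailey_ker q 0 n l = (qprod x x n.*2)^-1.
  apply: (mulfI (qf_neq0 q1 n.*2)).
  by rewrite -e qprod_sqr; field; rewrite xf0.
have : x ^- n * \sum_(l < n.+1) (if l == 0%N :> nat then x ^+ n
      else x ^+ (n - l) + x ^+ (n + l)) * bailey_ker q 0 n l = x ^- n / qprod x x n.*2.
  by rewrite e2.
move <-; rewrite mulr_sumr; apply: eq_bigr => l _.
rewrite mulrA; congr (_ * _); case: eqP => [_|_]; first by rewrite mulVf.
rewrite exprD; have -> : x ^+ n = x ^+ (n - l) * x ^+ l by rewrite -exprD subnK // -ltnS.
by field; rewrite !x0'.
Qed.

(** One Bailey step applied to [gauss_pair]: since (x; x)_(2s) = (x; q)_s (q; q)_s, the new beta is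
    a q-Chu-Vandermonde sum with c = x. *)
Lemma initial_pair_gauss :
  bailey_pair q 0 (fun l => q ^+ (l * l) * (if l == 0%N then 1 else x ^+ l + x ^- l))
    (fun n => (qprod x x n.*2)^-1).
Proof.
have step n l (le_ln : (l <= n)%N) := bailey_step q1 0 le_ln.
have pair := bailey_pair_step step gauss_pair.
move=> n; have := pair n; under eq_bigr do rewrite addn0.
under [RHS]eq_bigr do rewrite addn0; move=> <-.
have c0 m : 1 - x * q ^+ m != 0 by rewrite -exprM -exprS.
have p0 m : qprod x q m != 0 by apply/prodf_neq0.
rewrite qprod_double invfM -(q_vandermonde n c0) mulr_suml; apply: eq_bigr => s _.
rewrite qprod_double -(qbinE q (n := n) (i := s)) -1?ltnS //.
have b0 : qbin q n s != 0.
  have := qf_neq0 q1 n; rewrite -(qbinE q (n := n) (i := s)) -1?ltnS //.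
  by rewrite mulf_eq0 negb_or => /andP[].
have -> : q ^+ (s * s) = q ^+ (s * s.-1) * x ^+ s * x ^+ s.
  rewrite -!exprM -!exprD; congr (_ ^+ _); case: (nat_of_ord s) => [|m] /=; nia.
by field; rewrite !p0 b0 !qf_neq0 // x0'.
Qed.

(** The solution of gamma_l - q^(2l-1) gamma_(l-1) = (1 - x) alpha_l, where alpha is that of
    [initial_pair_gauss]. *)
Definition gamma0 l : F := x ^+ (2 * (l * l)) / x ^+ l * (1 - x ^+ l.*2.+1).

(** The conversion [bailey_pair_1to0] keeps beta. So beta may be computed after it, where alpha is 1
    - x times that of [initial_pair_gauss]. *)
Lemma initial_pair :
  bailey_pair q 1 (fun l => gamma0 l * (1 - q ^+ l.*2.+1))
    (fun n => (1 - x) / qprod x x n.*2).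
Proof.
pose beta n := \sum_(l < n.+1) gamma0 l * (1 - q ^+ l.*2.+1) * bailey_ker q 1 n l.
have pair : bailey_pair q 1 (fun l => gamma0 l * (1 - q ^+ l.*2.+1)) beta by [].
move=> n; rewrite -[RHS]/(beta n) (bailey_pair_1to0 q1 pair).
rewrite initial_pair_gauss mulr_sumr; apply: eq_bigr => l _; rewrite mulrA.
congr (_ * _); rewrite /gamma0; case: (nat_of_ord l) => [|m] /=.
  by rewrite -[0.*2.+1]/1%N !muln0 !expr0 invr1 expr1; ring.
have -> : x ^+ (2 * (m.+1 * m.+1)) = q ^+ (m.+1 * m.+1) by rewrite exprM.
have -> : q ^+ (m.+1 * m.+1) = x ^+ (2 * (m * m)) * x ^+ m * x ^+ m * x ^+ m * x ^+ m * x ^+ 2.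
  by rewrite -exprM -!exprD; congr (_ ^+ _); lia.
rewrite (_ : q ^+ m.*2.+1 = x ^+ m * x ^+ m * x ^+ m * x ^+ m * x ^+ 2); last first.
  by rewrite -exprM -!exprD; congr (_ ^+ _); lia.
rewrite (_ : m.*2.+1 = m + m + 1)%N; last by lia.
rewrite (_ : m.+1.*2.+1 = m + m + 3)%N; last by lia.
by rewrite !exprS !exprD expr1; field; rewrite x0' x0.
Qed.

End InitialPair.

(** * The finite Jacobi triple product *)

Section JacobiPair.
Variables (F : fieldType) (b y : F).
Hypothesis b0 : b != 0.
Hypothesis y0 : y != 0.
Hypothesis b1 : forall m, 1 - (b ^+ 2) ^+ m.+1 != 0.

(* For l > 0, the sum of the terms of index l and -l of the bilateral series
   of b^(l^2) y^l. *)
Definition theta_coef l : F := if l == 0%N then 1 else b ^+ (l * l) * (y ^+ l + y ^- l).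

(** The q-binomial theorem of order 2 n, base b^2 and t = b y / b^(2n), folded around the index
    n. *)
Lemma jacobi_pair :
  bailey_pair (b ^+ 2) 0 theta_coef
    (fun n => qprod (- (b * y)) (b ^+ 2) n * qprod (- (b / y)) (b ^+ 2) n /
              qprod (b ^+ 2) (b ^+ 2) n.*2).
Proof.
move: b1; have [p pb] : exists p, p = b ^+ 2 by exists (b ^+ 2).
rewrite -pb => p1 n.
have b0' m : b ^+ m != 0 by rewrite expf_neq0.
have y0' m : y ^+ m != 0 by rewrite expf_neq0.
have pE m : p ^+ m = b ^+ (2 * m) by rewrite pb exprM.
have p0 m : p ^+ m != 0 by rewrite pE.
(* Completing the square, h (n + l) / h n = b^(l^2) y^l for l positive or negative, hence the theta
   coefficients. *)
pose h i := b ^+ (i * i) * y ^+ i / b ^+ (2 * n * i).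
have hE i : p ^+ 'C(i, 2) * (b * y / p ^+ n) ^+ i = h i.
  rewrite /h !exprMn exprVn !pE -exprM.
  rewrite -(_ : 2 * 'C(i, 2) + i = i * i)%N ?exprD; last first.
    by rewrite -mul_bin_diag bin1; case: i => //= i; lia.
  by ring.
have := sum_qbin_fold p1 n h; under eq_bigr do rewrite -hE.
rewrite q_binomial => e.
have hn : h n = \prod_(i < n) (b * y / p ^+ i.+1).
  rewrite /h; elim: (n) => [|m IH]; first by rewrite big_ord0 !muln0 !expr0 divr1 mulr1.
  rewrite big_ord_recr /= -IH pE.
  rewrite (_ : m.+1 * m.+1 = m * m + m + m + 1)%N; last by lia.
  rewrite (_ : 2 * m.+1 * m.+1 = m * m + m * m + m + m + m + m + 2)%N; last by lia.
  rewrite (_ : 2 * m * m = m * m + m * m)%N; last by lia.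
  rewrite (_ : 2 * m.+1 = m + m + 2)%N; last by lia.
  by rewrite [in LHS]exprS !exprD !expr1; field; rewrite !b0' b0.
(* The upper half of the product is (- b y; p)_n. In the lower half, read backwards, 1 + b y /
   p^(i+1) is b y / p^(i+1) times 1 + (b / y) p^i. *)
have prodE : \prod_(i < n.*2) (1 + b * y / p ^+ n * p ^+ i) =
    h n * (qprod (- (b * y)) p n * qprod (- (b / y)) p n).
  rewrite -addnn big_split_ord /= mulrC mulrCA; congr (_ * _).
    by apply: eq_bigr => i _; rewrite mulNr opprK exprD mulrA divfK.
  rewrite hn (reindex_inj rev_ord_inj) /= -big_split; apply: eq_bigr => i _ /=.
  have -> : p ^+ n = p ^+ i.+1 * p ^+ (n - i.+1) by rewrite -exprD subnKC.
  rewrite mulNr opprK exprS (_ : p * p ^+ i = b * b * p ^+ i); last by rewrite pb expr2.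
  by field; rewrite !p0 b0 y0.
apply: (mulfI (qf_neq0 p1 n.*2)); rewrite mulrCA mulfV ?qf_neq0 // mulr1.
have hn0 : h n != 0 by rewrite !mulf_neq0 // invr_neq0.
apply: (mulfI hn0); rewrite -prodE e mulrCA; congr (_ * _); rewrite mulr_sumr.
apply: eq_bigr => l _; rewrite mulrA; congr (_ * _).
rewrite /theta_coef; case: eqP => [_|_]; first by rewrite mulr1.
rewrite /h; move: {l}(nat_of_ord l) (ltnSE (ltn_ord l)) => l ln.
have [m ->] : exists m, n = (m + l)%N by exists (n - l)%N; rewrite subnK.
have -> : (m + l - l = m)%N by lia.
rewrite (_ : (m + l) * (m + l) = m * m + m * l + m * l + l * l)%N; last by lia.
rewrite (_ : 2 * (m + l) * (m + l) =
  m * m + m * l + m * l + l * l + (m * m + m * l + m * l + l * l))%N; last by lia.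
rewrite (_ : 2 * (m + l) * m = m * m + m * m + m * l + m * l)%N; last by lia.
rewrite (_ : (m + l + l) * (m + l + l) = m * m + m * l + m * l + m * l + m * l +
  l * l + l * l + l * l + l * l)%N; last by lia.
rewrite (_ : 2 * (m + l) * (m + l + l) = m * m + m * m + m * l + m * l + m * l +
  m * l + m * l + m * l + l * l + l * l + l * l + l * l)%N; last by lia.
by rewrite !exprD; field; rewrite !b0' !y0'.
Qed.

End JacobiPair.

(** * The Bailey chain behind the multiple sum *)

Section Nested.
Variables (F : fieldType).

(** A multiple sum over n >= s_i >= s_(i+1) >= ..., written recursively so that each layer can be
    one step of a Bailey chain. *)
Fixpoint nested (g : nat -> nat -> nat -> F) (e : nat -> F) m i n : F :=
  if m is m'.+1 then \sum_(s < n.+1) g i n s * nested g e m' i.+1 s else e n.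

End Nested.

Section Chain.
Variables (F : fieldType) (x : F).
Hypothesis x1 : forall m, 1 - x ^+ m.+1 != 0.
Hypothesis x0 : x != 0.

Local Notation q := (x ^+ 2).

Let q1 m : 1 - q ^+ m.+1 != 0.
Proof. by rewrite -exprM mul2n doubleS. Qed.

Let x0' m : x ^+ m != 0. Proof. by rewrite expf_neq0. Qed.
Let q0 : q != 0. Proof. exact: x0'. Qed.

Variables (k r : nat).
Hypothesis rk : (r <= k)%N.

(** Each of the r inner steps, relative to a = q, multiplies [gamma0] by q^(l (l+1)); [alpha_r] is
    what [bailey_pair_1to0] makes of the result. *)
Definition gamma_r l : F := q ^+ (r * (l * l.+1)) * gamma0 x l.

Definition alpha_r l : F :=
  gamma_r l - (if l is m.+1 then q ^+ m.*2.+1 * gamma_r m else 0).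

Section AlphaFinal.
Variable j : nat.

(** The parameter y of the theta series of index s. With b = x^(2k+2), the choice e = 1 - 2 r gives
    the first triple of [rhs] and e = - 1 - 2 r the second. *)
Let Y (e : int) s := x ^ (e + 2 * j%:Z - 4 * s%:Z).

(** In the binomial expansion of (q^l + q^(-l))^j, the term of index s is q^(l (j-2s)), which shifts
    the exponent e by 2 j - 4 s. Next to - e the two summands are swapped, so that Y and its inverse
    get the same coefficient. *)
Lemma sum_Y (e : int) l :
  \sum_(s < j.+1) 'C(j, s)%:R * (Y e s ^+ l + Y e s ^- l) =
  ((x ^+ l) ^ e + (x ^+ l) ^ (- e)) * (q ^+ l + q ^- l) ^+ j.
Proof.
rewrite exprAC; set z := x ^+ l.
have z0 : z != 0 := x0' l.
have z0' m : z ^+ m != 0 by rewrite expf_neq0.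
have Yl s : (s <= j)%N ->
    Y e s ^+ l = z ^ e * ((z ^+ 2) ^+ (j - s) * (z ^- 2) ^+ s).
  move=> sj; rewrite /Y [LHS]exprnP exprzAC -[x ^ l]exprnP -/z.
  rewrite (_ : e + 2 * j%:Z - 4 * s%:Z = e + Posz (2 * (j - s)) + - Posz (2 * s)); last by lia.
  by rewrite !expfzDr // -exprnN -exprnP !exprM exprVn mulrA.
have -> : (z ^ e + z ^ (- e)) * (z ^+ 2 + z ^- 2) ^+ j =
    z ^ e * (z ^+ 2 + z ^- 2) ^+ j + z ^ (- e) * (z ^- 2 + z ^+ 2) ^+ j.
  by rewrite mulrDl [z ^- 2 + _]addrC.
rewrite !exprDn !mulr_sumr -big_split /=.
apply: eq_bigr => s _; rewrite Yl -1?ltnS // -[z ^ (- e)]invr_expz.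
rewrite mulr_natl !mulrnAr -mulrnDl; congr (_ *+ _).
have ze0 : z ^ e != 0 by rewrite expfz_neq0.
by rewrite !exprVn; field; rewrite ze0 !expf_neq0.
Qed.

(** Up to the power b^(l^2), [alpha_r] consists of four powers of x^l: a pair with exponents
    opposite to each other for e = 1 - 2 r, and another, with coefficient - x, for e = - 1 - 2 r.
    Then [sum_Y] absorbs the power j. *)
Lemma alpha_final l :
  q ^+ ((k - r) * (l * l)) * (q ^+ l + q ^- l) ^+ j * alpha_r l =
  \sum_(s < j.+1) 'C(j, s)%:R *
     (theta_coef (x ^+ (2 * k + 2)) (Y (1 - 2 * r%:Z) s) l -
      x * theta_coef (x ^+ (2 * k + 2)) (Y (- 1 - 2 * r%:Z) s) l).
Proof.
(* The index 0 is apart: its theta coefficient is 1, whereas the formula for l > 0 would give 2. *)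
case: l => [|l].
  have -> : alpha_r 0 = 1 - x.
    rewrite /alpha_r /gamma_r /gamma0 -[0.*2.+1]/1%N !mul0n !muln0 !expr0 invr1 expr1; ring.
  rewrite !muln0 !expr0 invr1 mul1r exprDn mulr_suml; apply: eq_bigr => s _.
  by rewrite /theta_coef /= mulr1 !expr1n mul1r.
rewrite /theta_coef /=.
set B := (x ^+ (2 * k + 2)) ^+ _; set X := q ^+ _ + _.
pose S e := \sum_(s < j.+1) 'C(j, s)%:R * (Y e s ^+ l.+1 + Y e s ^- l.+1).
transitivity (B * S (1 - 2 * r%:Z) - x * (B * S (- 1 - 2 * r%:Z))); last first.
  by rewrite !mulr_sumr -sumrB; apply: eq_bigr => s _; ring.
rewrite /S !sum_Y -/X; set z := x ^+ l.+1.
have z0 : z != 0 := x0' _.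
have -> : B = q ^+ ((k - r) * (l.+1 * l.+1)) * q ^+ (r * (l.+1 * l.+1)) * q ^+ (l.+1 * l.+1).
  by rewrite /B -!exprM -!exprD; congr (_ ^+ _); nia.
have -> : z ^ (1 - 2 * r%:Z) = z / z ^+ (2 * r).
  by rewrite expfzDr // expr1z -invr_expz.
have -> : z ^ (- 1 - 2 * r%:Z) = (z * z ^+ (2 * r))^-1.
  by rewrite expfzDr // -!invr_expz expr1z invfM.
have -> : z ^ (- (1 - 2 * r%:Z)) = z ^+ (2 * r) / z.
  by rewrite opprB expfzDr // exprN1.
have -> : z ^ (- (- 1 - 2 * r%:Z)) = z * z ^+ (2 * r).
  by rewrite opprD !opprK expfzDr // expr1z.
suff -> : alpha_r l.+1 = q ^+ (r * (l.+1 * l.+1)) * q ^+ (l.+1 * l.+1) *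
   (z / z ^+ (2 * r) + z ^+ (2 * r) / z - x * ((z * z ^+ (2 * r))^-1 + z * z ^+ (2 * r))).
  by ring.
rewrite /alpha_r /gamma_r /gamma0.
have -> : q ^+ (r * (l.+1 * l.+2)) = q ^+ (r * (l.+1 * l.+1)) * z ^+ (2 * r).
  by rewrite /z -!exprM -!exprD; congr (_ ^+ _); lia.
have -> : q ^+ (r * (l.+1 * l.+1)) = q ^+ (r * (l * l.+1)) * z ^+ (2 * r).
  by rewrite /z -!exprM -!exprD; congr (_ ^+ _); lia.
have -> : x ^+ (2 * (l.+1 * l.+1)) = q ^+ (l.+1 * l.+1) by rewrite exprM.
have -> : q ^+ (l.+1 * l.+1) = x ^+ (2 * (l * l)) * x ^+ l * x ^+ l * x ^+ l * x ^+ l * x ^+ 2.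
  by rewrite -exprM -!exprD; congr (_ ^+ _); lia.
have -> : q ^+ l.*2.+1 = x ^+ l * x ^+ l * x ^+ l * x ^+ l * x ^+ 2.
  by rewrite -exprM -!exprD; congr (_ ^+ _); lia.
rewrite (_ : l.*2.+1 = l + l + 1)%N; last by lia.
rewrite (_ : l.+1.*2.+1 = l + l + 3)%N; last by lia.
have -> : z = x ^+ l * x by rewrite /z exprSr.
rewrite !exprMn.
by rewrite !exprD expr1 ?exprS; field; rewrite !x0' x0 (expf_neq0 _ (x0' l)).
Qed.

End AlphaFinal.

Variable I : seq nat.
Hypothesis uI : uniq I.
Hypothesis hI : all (fun i => 1 <= i <= k - r)%N I.

(* The weight of s_i = s when s_(i-1) = n; here s_0 is an additional variable,
   which tends to infinity in the end. *)
Definition weight i n s : F :=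
  q ^+ (s * s + (if (k - r < i)%N then s else 0%N)) *
  (if i \in I then q ^+ n + q ^- s else 1) / qprod q q (n - s).

Definition nested_sum := nested weight (fun n => (1 - x) / qprod x x n.*2).

(** The m innermost indices exceed k - r, hence lie outside I and have weight q^(s^2+s): their sums
    are plain steps relative to a = q. *)
Lemma nested_sum_pair1 m : (m <= r)%N ->
  bailey_pair q 1 (fun l => q ^+ (m * (l * l.+1)) * gamma0 x l * (1 - q ^+ l.*2.+1))
    (nested_sum m (k - m).+1).
Proof.
elim: m => [|m IH] mr n.
  rewrite /nested_sum /= (initial_pair x1 x0); apply: eq_bigr => l _.
  by rewrite mul0n expr0 mul1r.
have step n' l (le_ln : (l <= n')%N) := bailey_step q1 1 le_ln.
have := bailey_pair_step step (IH (ltnW mr)) n.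
have -> : (k - m.+1).+1 = (k - m)%N by lia.
have ki : (k - r < k - m)%N by lia.
have kI : (k - m)%N \in I = false.
  by apply/negbTE/negP => /(allP hI); lia.
rewrite /nested_sum /=; under eq_bigr => s _.
  have -> : q ^+ (s * (s + 1)) / qprod q q (n - s) = weight (k - m) n s.
    by rewrite /weight ki kI mulr1; congr (q ^+ _ / _); lia.
  over.
move=> ->; apply: eq_bigr => l _.
rewrite (_ : m.+1 * (l * l.+1) = l * (l + 1) + m * (l * l.+1))%N; last by lia.
by rewrite exprD; ring.
Qed.

(** Once the r inner sums are converted to a = 1, each outer sum is an instance of
    [bailey_step_factor] or of [bailey_step], according to whether its index is in I. The count is
    the number of additional factors met so far. *)
Lemma nested_sum_pair0 m : (m <= k - r)%N ->
  bailey_pair q 0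
    (fun l => q ^+ (m * (l * l)) * (q ^+ l + q ^- l) ^+ count (fun i => k - r - m < i)%N I
              * alpha_r l)
    (nested_sum (r + m) (k - r - m).+1).
Proof.
elim: m => [|m IH] mk n.
  rewrite addn0 subn0.
  have := bailey_pair_1to0 q1 (nested_sum_pair1 (leqnn r)) => ->.
  apply: eq_bigr => l _; rewrite mul0n expr0 mul1r.
  have -> : count (fun i => k - r < i)%N I = 0%N.
    apply/eqP; rewrite eqn0Ngt -has_count; apply/negP => /hasP[i /(allP hI)]; lia.
  by rewrite expr0 mul1r.
have mi : (k - r - m.+1).+1 = (k - r - m)%N by lia.
have step n' l : (l <= n')%N ->
  \sum_(l <= s < n'.+1) weight (k - r - m) n' s * bailey_ker q 0 s l =
  q ^+ (l * l) * (q ^+ l + q ^- l) ^+ (k - r - m \in I)%N * bailey_ker q 0 n' l.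
  have ki : (k - r < k - r - m)%N = false by lia.
  move=> le_ln; rewrite /weight ki; case: (k - r - m \in I)%N.
    rewrite expr1 -(bailey_step_factor q1 q0 le_ln).
    by apply: eq_bigr => s _; rewrite addn0.
  rewrite expr0 mulr1 -[X in (l * X)%N]addn0 -(bailey_step q1 0 le_ln).
  by apply: eq_bigr => s _; rewrite !addn0 mulr1.
have pair := bailey_pair_step step (IH (ltnW mk)) n.
rewrite addnS mi; apply: (etrans pair); apply: eq_bigr => l _; congr (_ * _).
(* As I has no repetition, the index k - r - m contributes at most one factor. *)
have -> : count (fun i => k - r - m <= i)%N I =
    ((k - r - m \in I) + count (fun i => k - r - m < i)%N I)%N.
  rewrite -(count_uniq_mem _ uI) /=; elim: (I) => //= i J ->.
  by case: (ltngtP i (k - r - m)) => /=; lia.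
rewrite mulSn [_ ^+ (l * l + _)]exprD [_ ^+ (_ + count _ _)]exprD; ring.
Qed.

End Chain.

(** * Dominated convergence for unconditional sums *)

Local Open Scope classical_set_scope.

#[local] Existing Instance totally_filter.

Section Summation.
Variables (R : realType) (I : choiceType) (M : I -> R).
Hypothesis M0 : forall i, 0 <= M i.

Lemma ler_sum_uniq_sub (s t : seq I) : uniq s -> uniq t -> {subset s <= t} ->
  \sum_(i <- s) M i <= \sum_(i <- t) M i.
Proof.
move=> us ut st.
have /(perm_big _) -> : perm_eq s [seq i <- t | i \in s].
  apply: uniq_perm; rewrite ?filter_uniq // => i; rewrite mem_filter.
  by case: (boolP (i \in s)) => // /st ->.
rewrite big_filter [leRHS](bigID (mem s)) /= lerDl sumr_ge0 //.
Qed.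

(** Take s0 whose sum is within e of the supremum of all finite sums: a family disjoint from s0
    cannot add more than e. *)
Lemma small_tail (C : R) :
  (forall s : seq I, uniq s -> \sum_(i <- s) M i <= C) ->
  forall e, 0 < e -> exists s0 : seq I,
    forall s, uniq s -> {in s, forall i, i \notin s0} -> \sum_(i <- s) M i <= e.
Proof.
move=> MC e e0; pose E := [set x | exists2 s : seq I, uniq s & x = \sum_(i <- s) M i].
have ubE : has_ubound E by exists C => _ [s us ->]; exact: MC.
have [|_ [s0 us0 ->] lt_s0] := @sup_adherent R E e e0.
  by split=> //; exists 0, [::]; rewrite // big_nil.
exists s0 => s us dis.
have : \sum_(i <- s0 ++ s) M i <= sup E.
  apply: ub_le_sup => //; exists (s0 ++ s) => //.
  by rewrite cat_uniq us0 us andbT; apply/hasPn => i /dis.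
by rewrite big_cat /=; lra.
Qed.

End Summation.

Lemma partial_sumE (I : choiceType) (V : zmodType) (h : I -> V) (J : {fset I}) :
  partial_sum h J = \sum_(i <- J) h i.
Proof. by rewrite /partial_sum big_seq_fsetE. Qed.

(* Instances of topological structures are inferred on a numFieldType but not on
   the bare type R[i], so the analysis is done over a numFieldType which is
   complete for a real-valued absolute value. *)
Record absval (R : realType) (K : numFieldType) (nm : K -> R) : Prop := {
  nmM : {morph nm : x y / x * y};
  nmD : forall x y, nm (x + y) <= nm x + nm y;
  nmN : forall x, nm (- x) = nm x;
  nm1 : nm 1 = 1;
  nm0_eq : forall x, nm x = 0 <-> x = 0;
  nm_ge0 : forall x, 0 <= nm x;
  nm_cvg : forall (T : Type) (F : set_system T), Filter F -> forall (u : T -> K) (l : K),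
    u @ F --> l <-> forall d, 0 < d -> \forall x \near F, nm (l - u x) <= d;
  nm_complete : forall (u : nat -> K) (C rho : R), 0 <= rho < 1 ->
    (forall n, nm (u n.+1 - u n) <= C * rho ^+ n) -> cvg (u @ \oo)
}.

Section Absval.
Variables (R : realType) (K : numFieldType) (nm : K -> R) (nmP : absval nm).

Lemma nm0 : nm 0 = 0. Proof. exact/(nm0_eq nmP). Qed.

Lemma nm_gt0 x : x != 0 -> 0 < nm x.
Proof.
move=> x0; rewrite lt_neqAle (nm_ge0 nmP) andbT eq_sym.
by apply: contra x0 => /eqP/(nm0_eq nmP)->.
Qed.

Lemma nmX x n : nm (x ^+ n) = nm x ^+ n.
Proof. by elim: n => [|n IH]; rewrite ?(nm1 nmP) // !exprS (nmM nmP) IH. Qed.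

Lemma nmV x : nm x^-1 = (nm x)^-1.
Proof.
have [->|x0] := eqVneq x 0; first by rewrite invr0 nm0 invr0.
have n0 := lt0r_neq0 (nm_gt0 x0).
by apply: (mulfI n0); rewrite -(nmM nmP) !mulfV // (nm1 nmP).
Qed.

Lemma nmB x y : nm (x - y) <= nm x + nm y.
Proof. by rewrite -[nm y](nmN nmP); exact: nmD. Qed.

Lemma nm_dist x y : nm (x - y) = nm (y - x).
Proof. by rewrite -(nmN nmP) opprB. Qed.

Lemma nm_sum (J : Type) (s : seq J) (P : pred J) (f : J -> K) :
  nm (\sum_(i <- s | P i) f i) <= \sum_(i <- s | P i) nm (f i).
Proof.
elim/big_rec2: _ => [|i x y _ H]; first by rewrite nm0.
by apply: (le_trans (nmD nmP _ _)); rewrite lerD2l.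
Qed.

Lemma nm_prod (J : Type) (s : seq J) (f : J -> K) :
  nm (\prod_(i <- s) f i) = \prod_(i <- s) nm (f i).
Proof. exact: (big_morph nm (nmM nmP) (nm1 nmP)). Qed.

Lemma cvg_nm_bounded (u : nat -> K) (l : K) : u @ \oo --> l ->
  exists2 C, 0 < C & forall n, nm (u n) <= C.
Proof.
move/(nm_cvg nmP) => /(_ 1 ltr01) [N _ uN].
exists (\sum_(i < N) nm (u i) + nm l + 1).
  rewrite ltr_wpDl //; apply: addr_ge0; rewrite ?(nm_ge0 nmP) // sumr_ge0 // => i _.
  exact: (nm_ge0 nmP).
move=> n; case: (ltnP n N) => nN.
  rewrite -addrA ler_wpDr ?addr_ge0 ?(nm_ge0 nmP) //.
  rewrite (bigD1 (Ordinal nN)) //= lerDl sumr_ge0 // => i _; exact: (nm_ge0 nmP).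
rewrite -addrA ler_wpDl ?sumr_ge0 // => [i _|]; first exact: (nm_ge0 nmP).
have := uN n nN; have := nmB l (l - u n).
by rewrite subKr => h1 h2; lra.
Qed.

Lemma cvg_lim_nm (u : nat -> K) (l : K) : u @ \oo --> l -> lim (u @ \oo) = l.
Proof. exact: (@cvg_lim K). Qed.

Section Tannery.
Variables (I : choiceType) (f : nat -> I -> K) (g : I -> K) (M : I -> R).
Variables (A : nat -> seq I) (C : R).
Hypothesis uA : forall n, uniq (A n).
Hypothesis A_exhaust : forall i, \forall n \near \oo, i \in A n.
Hypothesis M0 : forall i, 0 <= M i.
Hypothesis MC : forall n, \sum_(i <- A n) M i <= C.
Hypothesis fM : forall n i, i \in A n -> nm (f n i) <= M i.
Hypothesis fg : forall i, f ^~ i @ \oo --> g i.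

Lemma near_all_mem (s : seq I) : \forall n \near \oo, {subset s <= A n}.
Proof.
elim: s => [|i s IH]; first by near=> n => ? //.
near=> n => z; rewrite inE => /orP[/eqP->|]; first by near: n; exact: A_exhaust.
move: z; near: n; exact: IH.
Unshelve. all: by end_near. Qed.

(** The part of A n outside J is controlled by a tail of M, at most e / 2 once J contains J0; on the
    finite set J the convergence is termwise. *)
Lemma tannery_core e : 0 < e ->
  exists J0 : {fset I}, forall J : {fset I}, (J0 `<=` J)%fset ->
  \forall n \near \oo, nm (\sum_(i <- A n) f n i - partial_sum g J) <= e.
Proof.
move=> e0; have e2 : 0 < e / 2 by lra.
(* Every finite family is contained in some A N, which passes the bound C on to it. *)
have MC' (s : seq I) : uniq s -> \sum_(i <- s) M i <= C.
  move=> us; have [N _ /(_ N (leqnn N)) sN] := near_all_mem s.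
  by apply: le_trans (MC N); exact: ler_sum_uniq_sub.
have [s0 s0P] := small_tail MC' e2.
exists (seq_fset tt s0) => J J0J.
have cvJ : (fun n => \sum_(i <- J) f n i) @ \oo --> \sum_(i <- J) g i.
  by apply: cvg_big => [|i _]; [exact: add_continuous|exact: fg].
move/(nm_cvg nmP): cvJ => /(_ _ e2) nearJ.
near=> n; rewrite partial_sumE.
have JA : {subset J <= A n} by near: n; exact: near_all_mem.
rewrite (bigID (mem J)) /=.
have -> : \sum_(i <- A n | i \in J) f n i = \sum_(i <- J) f n i.
  rewrite -big_filter; apply: perm_big; apply: uniq_perm; rewrite ?filter_uniq ?fset_uniq //.
  by move=> i; rewrite mem_filter; case: (boolP (i \in J)) => // /JA ->.
rewrite addrAC; apply: (le_trans (nmD nmP _ _)).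
rewrite [leRHS](_ : e = e / 2 + e / 2); last by lra.
apply: lerD; first by rewrite nm_dist; near: n.
apply: (le_trans (nm_sum _ _ _)).
apply: (@le_trans _ _ (\sum_(i <- A n | i \notin J) M i)).
  by rewrite big_seq_cond [leRHS]big_seq_cond; apply: ler_sum => i /andP[/fM].
rewrite -big_filter; apply: s0P; rewrite ?filter_uniq // => i.
rewrite mem_filter => /andP[+ _]; apply: contra => is0.
by apply: (fsubsetP J0J); rewrite seq_fsetE.
Unshelve. all: by end_near. Qed.

(** This direction evaluates an unconditional sum from the limit of its finite versions;
    [tannery_cvg] is the converse. Theta series need the first, and then the second when summed
    against a kernel. *)
Lemma tannery_sums_to (l : K) :
  (fun n => \sum_(i <- A n) f n i) @ \oo --> l -> sums_to g l.
Proof.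
move/(nm_cvg nmP) => cvl; apply/(nm_cvg nmP) => e e0.
have e2 : 0 < e / 2 by lra.
have [J0 J0P] := tannery_core e2.
exists J0 => // J /= J0J; have nearJ := J0P J J0J; have nearl := cvl _ e2.
near \oo => n.
rewrite [X in nm X](_ : _ = l - \sum_(i <- A n) f n i +
   (\sum_(i <- A n) f n i - partial_sum g J)); last by rewrite addrA subrK.
apply: (le_trans (nmD nmP _ _)); rewrite [leRHS](_ : e = e / 2 + e / 2); last by lra.
by apply: lerD; near: n.
Unshelve. all: by end_near. Qed.

Lemma tannery_cvg (l : K) :
  sums_to g l -> (fun n => \sum_(i <- A n) f n i) @ \oo --> l.
Proof.
move/(nm_cvg nmP) => cvl; apply/(nm_cvg nmP) => e e0.
have e2 : 0 < e / 2 by lra.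
have [J0 J0P] := tannery_core e2.
have [J1 _ J1P] := cvl _ e2.
have := J1P (J0 `|` J1)%fset (fsubsetUr _ _); rewrite /= => h1.
have nearJ := J0P (J0 `|` J1)%fset (fsubsetUl _ _).
near=> n.
rewrite [X in nm X](_ : _ = l - partial_sum g (J0 `|` J1)%fset +
   (partial_sum g (J0 `|` J1)%fset - \sum_(i <- A n) f n i)); last by rewrite addrA subrK.
apply: (le_trans (nmD nmP _ _)); rewrite [leRHS](_ : e = e / 2 + e / 2); last by lra.
by apply: lerD => //; rewrite nm_dist; near: n.
Unshelve. all: by end_near. Qed.

End Tannery.
End Absval.

(** * Infinite q-Pochhammer symbols *)

Lemma cvg_geometric_steps (R : realType) (u : nat -> R) (C rho : R) :
  0 <= rho < 1 -> (forall n, `|u n.+1 - u n| <= C * rho ^+ n) -> cvg (u @ \oo).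
Proof.
move=> /andP[rho0 rho1] uC.
have : cvgn [normed series (fun n => u n.+1 - u n)].
  apply: (@series_le_cvg _ _ (geometric C rho)) => [n|n|n|] /=.
  - exact: normr_ge0.
  - exact: le_trans (normr_ge0 _) (uC n).
  - exact: uC.
  - by apply: is_cvg_geometric_series; rewrite ger0_norm.
move/normed_cvg => cv.
have -> : u = (fun n => u 0%N + series (fun n => u n.+1 - u n) n).
  by apply/funext => n; rewrite /series /= telescope_sumr // addrC subrK.
by apply: is_cvgD => //; exact: is_cvg_cst.
Qed.

Section ComplexAbsval.
Variable R : realType.
Let K : numFieldType := R[i]%C.

Lemma normc_absval : absval (K := K) (@ComplexField.Normc.normc R).
Proof.
have normE (z : K) : `|z| = ((ComplexField.Normc.normc z)%:C)%C by [].
have cvgE (T : Type) (F : set_system T) : Filter F -> forall (u : T -> K) (l : K),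
    u @ F --> l <-> forall d, 0 < d -> \forall x \near F,
       ComplexField.Normc.normc (l - u x) <= d.
  move=> FF u l; split=> [/cvgrPdist_le ul d d0|ul].
    have := ul (d%:C)%C; rewrite ltcR => /(_ d0).
    by apply: filterS => x; rewrite normE lecR.
  (* A positive complex number is real, so the complex radii reduce to those in R. *)
  apply/cvgrPdist_le => e; rewrite ltcE /= => /andP[/eqP ei er].
  apply: filterS (ul _ er) => x; rewrite normE lecE /= ei eqxx /=.
  by [].
split=> //.
- exact: ComplexField.Normc.normcM.
- exact: le_normcD.
- exact: normcN.
- exact: ComplexField.Normc.normc1.
- move=> x; split=> [/ComplexField.Normc.eq0_normc//|->]; exact: ComplexField.Normc.normc0.
- by move=> [a b] /=; exact: sqrtr_ge0.
(* Completeness: real and imaginary parts inherit the geometric bound on the increments. *)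
move=> u C rho rho01 uC.
have ReC n : `|complex.Re (u n.+1) - complex.Re (u n)| <= C * rho ^+ n.
  apply: le_trans (uC n); case: (u n.+1) (u n) => [a b] [c d] /=.
  by rewrite -sqrtr_sqr ler_wsqrtr // lerDl sqr_ge0.
have ImC n : `|complex.Im (u n.+1) - complex.Im (u n)| <= C * rho ^+ n.
  apply: le_trans (uC n); case: (u n.+1) (u n) => [a b] [c d] /=.
  by rewrite -sqrtr_sqr ler_wsqrtr // lerDr sqr_ge0.
have /cvg_ex[a /cvgrPdist_le ua] := cvg_geometric_steps rho01 ReC.
have /cvg_ex[b /cvgrPdist_le ub] := cvg_geometric_steps rho01 ImC.
apply/cvg_ex; exists (Complex a b); apply/cvgE => d d0.
have d2 : 0 < d / 2 by lra.
near=> n.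
have ha : `|a - complex.Re (u n)| <= d / 2 by near: n; exact: ua.
have hb : `|b - complex.Im (u n)| <= d / 2 by near: n; exact: ub.
case: (u n) ha hb => [c e] /= ha hb.
have := le_normcD (Complex (a - c) 0) (Complex 0 (b - e)).
rewrite /= !expr0n /= !addr0 !add0r !sqrtr_sqr => h.
by apply: (le_trans h); lra.
Unshelve. all: by end_near. Qed.

End ComplexAbsval.

Section WeierstrassProduct.
Variable R : realDomainType.

Lemma prod_1sub_ge n (t : nat -> R) : (forall i, 0 <= t i <= 1) ->
  1 - \sum_(i < n) t i <= \prod_(i < n) (1 - t i).
Proof.
move=> t01; elim: n => [|n IH]; first by rewrite !big_ord0 subr0.
rewrite !big_ord_recr /=; have /andP[t0 t1] := t01 n.
have S0 : 0 <= \sum_(i < n) t i by apply: sumr_ge0 => i _; case/andP: (t01 i).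
have : (1 - \sum_(i < n) t i) * (1 - t n) <= \prod_(i < n) (1 - t i) * (1 - t n).
  by apply: ler_wpM2r => //; rewrite subr_ge0.
apply: le_trans; nra.
Qed.

(** The product of all (1 + t_i) (1 - t_i) is at most 1, so the lower bound of [prod_1sub_ge] turns
    into an upper bound. *)
Lemma prod_1add_le n (t : nat -> R) : (forall i, 0 <= t i <= 1) ->
  \prod_(i < n) (1 + t i) * (1 - \sum_(i < n) t i) <= 1.
Proof.
move=> t01; have := prod_1sub_ge n t01.
have P0 : 0 <= \prod_(i < n) (1 + t i).
  by apply: prodr_ge0 => i _; case/andP: (t01 i) => *; rewrite addr_ge0.
move/(ler_wpM2l P0)/le_trans; apply; rewrite -big_split /=.
apply: (@le_trans _ _ (\prod_(i < n) 1)); last by rewrite big1.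
apply: ler_prod => i _; case/andP: (t01 i) => h0 h1.
apply/andP; split; nra.
Qed.

End WeierstrassProduct.

Section QPochInf.
Variables (R : realType) (K : numFieldType) (nm : K -> R) (nmP : absval nm).
Variable q : K.
Hypothesis q1 : nm q < 1.

Let rho0 : 0 <= nm q := nm_ge0 nmP q.

Lemma geo_sum_le n : (\sum_(i < n) nm q ^+ i) * (1 - nm q) <= 1.
Proof.
have := subrX1 (nm q) n; rewrite -[X in X - _]opprK -opprB => /eqP.
rewrite -[in X in _ == X]opprB mulNr eqr_opp => /eqP; rewrite mulrC => <-.
by rewrite opprK lerBlDr lerDl exprn_ge0.
Qed.

Section Small.
Variable a : K.
Hypothesis a_small : nm a <= (1 - nm q) / 2.

Let t i := nm a * nm q ^+ i.

Let t01 i : 0 <= t i <= 1.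
Proof.
apply/andP; split; first by rewrite mulr_ge0 ?exprn_ge0 ?(nm_ge0 nmP).
rewrite -[leRHS]mulr1; apply: ler_pM; rewrite ?exprn_ge0 ?(nm_ge0 nmP) //.
  by move: a_small rho0; lra.
by apply: exprn_ile1; rewrite // ltW.
Qed.

Let sum_t n : \sum_(i < n) t i <= 1 / 2.
Proof.
rewrite /t -mulr_sumr; have := geo_sum_le n.
have : 0 <= \sum_(i < n) nm q ^+ i by apply: sumr_ge0 => i _; exact: exprn_ge0.
move: a_small (nm_ge0 nmP a); nra.
Qed.

(** The smallness of a bounds the sum of all |a q^i| by 1 / 2, which keeps the finite products
    between 1 / 2 and 2. The lower bound serves for nonvanishing, the upper one for convergence. *)
Lemma qprod_small_ge n : 1 / 2 <= nm (qprod a q n).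
Proof.
rewrite /qprod (nm_prod nmP).
have := prod_1sub_ge n t01; have := sum_t n => h1 h2.
have : \prod_(i < n) (1 - t i) <= \prod_(i < n) nm (1 - a * q ^+ i).
  apply: ler_prod => i _; have /andP[_ ti1] := t01 i; rewrite subr_ge0 ti1 /=.
  have := nmB nmP 1 (1 - a * q ^+ i); rewrite subKr => h.
  have := nmD nmP (a * q ^+ i) (1 - a * q ^+ i).
  by rewrite addrCA subrr addr0 (nm1 nmP) (nmM nmP) (nmX nmP) -/(t i); lra.
lra.
Qed.

Lemma qprod_small_le n : nm (qprod a q n) <= 2.
Proof.
rewrite /qprod (nm_prod nmP).
have := prod_1add_le n t01; have := sum_t n => h1 h2.
have h3 : \prod_(i < n) nm (1 - a * q ^+ i) <= \prod_(i < n) (1 + t i).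
  apply: ler_prod => i _; rewrite (nm_ge0 nmP) /=.
  by have := nmB nmP 1 (a * q ^+ i); rewrite (nm1 nmP) (nmM nmP) (nmX nmP).
apply: (le_trans h3).
have : 0 <= \prod_(i < n) (1 + t i).
  by apply: prodr_ge0 => i _; case/andP: (t01 i) => *; rewrite addr_ge0.
nra.
Qed.

Lemma qprod_small_cvg : cvg (qprod a q @ \oo).
Proof.
apply: (nm_complete nmP (C := 2 * nm a) (rho := nm q)).
  by rewrite rho0 q1.
move=> n; rewrite qprodS mulrBr mulr1 addrAC subrr add0r (nmN nmP) !(nmM nmP) (nmX nmP).
by rewrite mulrA ler_wpM2r ?exprn_ge0 // ler_wpM2r ?(nm_ge0 nmP) // qprod_small_le.
Qed.

End Small.

Lemma exists_small_tail a : exists N, nm (a * q ^+ N) <= (1 - nm q) / 2.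
Proof.
have e0 : 0 < (1 - nm q) / 2 by move: q1; lra.
have /(_ (nm a) (nm q)) := @cvg_geometric R; rewrite ger0_norm // => /(_ q1).
move=> /cvgrPdist_le /(_ _ e0) [N _ /(_ N (leqnn N))] /= h; exists N.
move: h; rewrite sub0r normrN ger0_norm ?mulr_ge0 ?exprn_ge0 ?(nm_ge0 nmP) //.
by rewrite (nmM nmP) (nmX nmP).
Qed.

(** After finitely many factors, a is replaced by a q^N, which is small. *)
Lemma qpoch_inf_cvg a : qprod a q @ \oo --> qpoch_inf a q.
Proof.
suff : cvg (qprod a q @ \oo) by [].
have [N /qprod_small_cvg cv] := exists_small_tail a.
have /cvg_ex[l hl] : cvg ((fun n => qprod a q (n + N)%N) @ \oo).
  under eq_fun do rewrite addnC qprodD.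
  by apply: is_cvgM => //; exact: is_cvg_cst.
by apply/cvg_ex; exists l; rewrite -(cvg_shiftn N (qprod a q)).
Qed.

Lemma qpoch_inf_shift a n :
  qpoch_inf a q = qprod a q n * qpoch_inf (a * q ^+ n) q.
Proof.
have c1 : (fun m => qprod a q (m + n)) @ \oo --> qpoch_inf a q.
  by rewrite (cvg_shiftn n (qprod a q)); exact: qpoch_inf_cvg.
have c2 : (fun m => qprod a q (m + n)) @ \oo --> qprod a q n * qpoch_inf (a * q ^+ n) q.
  under eq_fun do rewrite addnC qprodD.
  by apply: cvgM; [exact: cvg_cst|exact: qpoch_inf_cvg].
by rewrite -(cvg_lim_nm c1) (cvg_lim_nm c2).
Qed.

(** The first N factors do not vanish, and the remaining partial products have absolute value at
    least 1 / 2. *)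
Lemma qpoch_inf_neq0 a : (forall m, 1 - a * q ^+ m != 0) -> qpoch_inf a q != 0.
Proof.
move=> a0; have [N aN] := exists_small_tail a.
rewrite (qpoch_inf_shift a N) mulf_neq0 //; first exact/prodf_neq0.
apply/negP => /eqP l0; have := @qpoch_inf_cvg (a * q ^+ N); rewrite l0.
move/(nm_cvg nmP) => /(_ (1/4)) []; first by lra.
move=> m _ /(_ m (leqnn m)) /=; rewrite sub0r (nmN nmP).
by have := qprod_small_ge aN m; lra.
Qed.

Lemma one_sub_neq0 (x : K) : nm x < 1 -> 1 - x != 0.
Proof.
move=> x1; apply/negP; rewrite subr_eq0 => /eqP e; move: x1; rewrite -e (nm1 nmP).
by rewrite ltxx.
Qed.

Lemma nm_expS_lt1 m : nm (q ^+ m.+1) < 1.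
Proof. by rewrite (nmX nmP) exprn_ilt1. Qed.

Lemma one_sub_exp_neq0 m : 1 - q ^+ m.+1 != 0.
Proof. exact: one_sub_neq0 (nm_expS_lt1 m). Qed.

Lemma qpoch_qE n : qpoch q q n = qprod q q n.
Proof.
rewrite /qpoch (qpoch_inf_shift q n) mulfK //; apply: qpoch_inf_neq0 => m.
by rewrite -exprS -exprD addSn one_sub_exp_neq0.
Qed.

Lemma qpoch_inf_q_neq0 : qpoch_inf q q != 0.
Proof. by apply: qpoch_inf_neq0 => m; rewrite -exprS one_sub_exp_neq0. Qed.

Lemma qfV_cvg : (fun n => (qprod q q n)^-1) @ \oo --> (qpoch_inf q q)^-1.
Proof. by apply: cvgV; [exact: qpoch_inf_q_neq0|exact: qpoch_inf_cvg]. Qed.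

Lemma qfV_bound : exists2 C, 0 < C & forall n, nm (qprod q q n)^-1 <= C.
Proof. exact: (cvg_nm_bounded nmP qfV_cvg). Qed.

End QPochInf.

(** * Theta functions and multiple sums *)

Section SumsTo.
Variables (K : numFieldType) (I : choiceType).

Lemma sums_toZ c (f : I -> K) l : sums_to f l -> sums_to (fun i => c * f i) (c * l).
Proof.
move=> fl; rewrite /sums_to.
rewrite (_ : partial_sum _ = (fun J => c * partial_sum f J)).
  by apply: cvgM => //; exact: cvg_cst.
by apply/funext => J; rewrite /partial_sum mulr_sumr.
Qed.

Lemma eq_sums_to (f g : I -> K) l : f =1 g -> sums_to f l -> sums_to g l.
Proof. by move=> /funext ->. Qed.

End SumsTo.

Section ThetaLimit.
Variables (R : realType) (K : numFieldType) (nm : K -> R) (nmP : absval nm).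

Section BaileyLimit.
Variables (q : K) (alpha beta : nat -> K) (M : nat -> R) (C : R).
Hypothesis q1 : nm q < 1.
Hypothesis pair : bailey_pair q 0 alpha beta.
Hypothesis M0 : forall l, 0 <= M l.
Hypothesis MC : forall n, \sum_(l < n) M l <= C.
Hypothesis alphaM : forall l, nm (alpha l) <= M l.

Let f n l := alpha l * bailey_ker q 0 n l.
Let g l := alpha l / (qpoch_inf q q) ^+ 2.

Let betaE : beta = (fun n => \sum_(l <- index_iota 0 n.+1) f n l).
Proof. by apply/funext => n; rewrite pair big_mkord. Qed.

Let fg l : f ^~ l @ \oo --> g l.
Proof.
apply: cvgM; first exact: cvg_cst.
rewrite /bailey_ker expr2 invfM; under eq_fun do rewrite invfM addn0.
apply: cvgM.
  rewrite -(cvg_shiftn l); under eq_fun do rewrite addnK.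
  exact: (qfV_cvg nmP q1).
by rewrite (cvg_shiftn l (fun n => (qprod q q n)^-1)); exact: (qfV_cvg nmP q1).
Qed.

Let exhaust (l : nat) : \forall n \near \oo, l \in index_iota 0 n.+1.
Proof. by exists l => // n /= ln; rewrite mem_index_iota. Qed.

Let bound : exists2 D, 0 <= D & forall n l, nm (bailey_ker q 0 n l) <= D.
Proof.
have [D D0 qfD] := qfV_bound nmP q1.
exists (D * D); first by rewrite mulr_ge0 // ltW.
move=> n l; rewrite /bailey_ker invfM (nmM nmP).
by apply: ler_pM; rewrite ?(nm_ge0 nmP).
Qed.

(** The kernel is bounded uniformly in n and l and tends to 1 / (q; q)_oo^2, so dominated
    convergence applies to the relation defining the pair. The converse is [bailey_cvg]. *)
Lemma bailey_sums_to l : beta @ \oo --> l -> sums_to g l.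
Proof.
rewrite betaE; have [D D0 bD] := bound.
apply: (tannery_sums_to nmP (M := fun l => M l * D) (C := C * D)) => //.
- by move=> n; exact: iota_uniq.
- by move=> i; rewrite mulr_ge0.
- by move=> n; rewrite big_mkord -mulr_suml ler_wpM2r.
- by move=> n i _; rewrite /f (nmM nmP) ler_pM ?(nm_ge0 nmP).
Qed.

Lemma bailey_cvg l : sums_to g l -> beta @ \oo --> l.
Proof.
rewrite betaE; have [D D0 bD] := bound.
apply: (tannery_cvg nmP (M := fun l => M l * D) (C := C * D)) => //.
- by move=> n; exact: iota_uniq.
- by move=> i; rewrite mulr_ge0.
- by move=> n; rewrite big_mkord -mulr_suml ler_wpM2r.
- by move=> n i _; rewrite /f (nmM nmP) ler_pM ?(nm_ge0 nmP).
Qed.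

End BaileyLimit.

Section Theta.
Variables (b y : K).
Hypothesis b0 : b != 0.
Hypothesis y0 : y != 0.
Hypothesis by1 : nm (b * y) < 1.
Hypothesis by2 : nm (b / y) < 1.

Let bb1 : nm (b ^+ 2) < 1.
Proof.
have -> : b ^+ 2 = (b * y) * (b / y) by field.
by rewrite (nmM nmP) mulr_ilt1 // (nm_ge0 nmP).
Qed.

Let b1 : nm b <= 1.
Proof.
rewrite leNgt; apply/negP => b1; move: bb1; rewrite (nmX nmP) expr2.
by apply/negP; rewrite -leNgt mulr_ege1 // ltW.
Qed.

(** A geometric majorant: b^(l^2) y^l = b^(l(l-1)) (b y)^l, likewise for 1 / y, and |b| <= 1. *)
Let M l := nm (b * y) ^+ l + nm (b / y) ^+ l.

Let M0 l : 0 <= M l.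
Proof. by rewrite addr_ge0 // exprn_ge0 // (nm_ge0 nmP). Qed.

Let thetaM l : nm (theta_coef b y l) <= M l.
Proof.
rewrite /theta_coef; case: eqP => [->|/eqP l0].
  by rewrite /M (nm1 nmP) !expr0 lerDl.
have -> : b ^+ (l * l) * (y ^+ l + y ^- l) =
   b ^+ (l * l.-1) * ((b * y) ^+ l + (b / y) ^+ l).
  rewrite (_ : l * l = l * l.-1 + l)%N; last by case: l l0 => // l; lia.
  by rewrite exprD !exprMn exprVn; ring.
rewrite (nmM nmP) -[leRHS]mul1r; apply: ler_pM; rewrite ?(nm_ge0 nmP) //.
  by rewrite (nmX nmP) exprn_ile1 // (nm_ge0 nmP).
by apply: (le_trans (nmD nmP _ _)); rewrite !(nmX nmP).
Qed.

Let MC n : \sum_(l < n) M l <= (1 - nm (b * y))^-1 + (1 - nm (b / y))^-1.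
Proof.
rewrite big_split /=; apply: lerD; rewrite -[leRHS]mul1r ler_pdivlMr ?subr_gt0 //;
  exact: geo_sum_le.
Qed.

Definition theta_inf : K := qpochs_inf [:: b ^+ 2; - (b * y); - (b / y)] (b ^+ 2).

(** The Jacobi triple product, obtained as the limit of [jacobi_pair] multiplied by (p; p)_oo^2. *)
Lemma theta_sums_to : sums_to (theta_coef b y) theta_inf.
Proof.
set p := b ^+ 2.
have p1 := one_sub_exp_neq0 nmP bb1.
have pn0 := qpoch_inf_q_neq0 nmP bb1.
pose L := qpoch_inf (- (b * y)) p * qpoch_inf (- (b / y)) p / qpoch_inf p p.
have cv : (fun n => qprod (- (b * y)) p n * qprod (- (b / y)) p n /
              qprod p p n.*2) @ \oo --> L.
  apply: cvgM; first by apply: cvgM; exact: (qpoch_inf_cvg nmP bb1).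
  apply: (@cvg_comp _ _ _ (fun n => n.*2) _ _ _ _ _ (qfV_cvg nmP bb1)).
  move=> A [N _ NA]; exists N => // n /= Nn; apply: NA => /=.
  by rewrite -addnn (leq_trans Nn) // leq_addr.
have := bailey_sums_to bb1 (jacobi_pair b0 y0 p1) M0 MC thetaM cv.
move/(sums_toZ (c := qpoch_inf p p ^+ 2)).
rewrite (_ : _ * L = theta_inf); last first.
  by rewrite /theta_inf /qpochs_inf !big_cons big_nil /L -/p; field.
by apply: eq_sums_to => l; rewrite mulrCA mulfV ?mulr1 // expf_neq0.
Qed.

(** The theta coefficients, which come from the base b^2, are summed here against the kernel of an
    independent base q. *)
Lemma theta_bailey_cvg q : nm q < 1 ->
  (fun n => \sum_(l < n.+1) theta_coef b y l * bailey_ker q 0 n l) @ \oo -->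
  theta_inf / qpoch_inf q q ^+ 2.
Proof.
move=> q1.
have pair : bailey_pair q 0 (theta_coef b y)
  (fun n => \sum_(l < n.+1) theta_coef b y l * bailey_ker q 0 n l) by [].
apply: (bailey_cvg q1 pair M0 MC thetaM).
have := sums_toZ (c := (qpoch_inf q q ^+ 2)^-1) theta_sums_to.
by rewrite mulrC; apply: eq_sums_to => l; rewrite mulrC.
Qed.

End Theta.
End ThetaLimit.

(** * Enumeration of decreasing sequences *)

Section DecreasingSequences.

Fixpoint decr_seqs m n : seq (seq nat) :=
  if m is m'.+1 then [seq s :: t | s <- iota 0 n.+1, t <- decr_seqs m' s] else [:: [::]].

Lemma mem_decr_seqs m n t : (t \in decr_seqs m n) = (size t == m) && path geq n t.
Proof.
elim: m n t => [|m IH] n t; first by rewrite inE; case: t.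
apply/allpairsPdep/idP => [[s [u [sn um ->]]]|].
  move: sn um; rewrite mem_iota add0n ltnS IH /= => sn /andP[/eqP -> pu].
  by rewrite eqxx /= pu andbT.
case: t => // s u /= /andP[]; rewrite eqSS => su /andP[ns pu].
exists s, u; split=> //; last by rewrite IH su.
by rewrite -/(iota 0 n.+1) mem_iota add0n ltnS.
Qed.

Lemma decr_seqs_uniq m n : uniq (decr_seqs m n).
Proof.
elim: m n => [//|m IH] n.
apply: allpairs_uniq_dep.
- exact: iota_uniq.
- by move=> s _; exact: IH.
- by move=> [s t] [s' t'] /= _ _ [-> ->].
Qed.

Variable F : fieldType.

(** The single term of [nested] that belongs to the sequence t, with n the value preceding its
    head. *)
Fixpoint path_weight (g : nat -> nat -> nat -> F) (e : nat -> F) i n (t : seq nat) : F :=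
  if t is s :: t' then g i n s * path_weight g e i.+1 s t' else e n.

Lemma sum_path_weight g e m i n :
  \sum_(t <- decr_seqs m n) path_weight g e i n t = nested g e m i n.
Proof.
elim: m i n => [|m IH] i n; first by rewrite big_seq1.
rewrite (_ : decr_seqs m.+1 n = [seq s :: t | s <- index_iota 0 n.+1, t <- decr_seqs m s]) //.
rewrite big_allpairs_dep big_mkord.
rewrite [RHS]/=; apply: eq_bigr => s _; rewrite -IH mulr_sumr.
by apply: eq_bigr.
Qed.

Lemma path_weight_prod g e i n t :
  path_weight g e i n t =
  \prod_(a < size t) g (i + a)%N (nth 0%N (n :: t) a) (nth 0%N t a) * e (last n t).
Proof.
elim: t i n => [|s t IH] i n /=; first by rewrite big_ord0 mul1r.
rewrite big_ord_recl /= addn0 -mulrA IH; congr (_ * (_ * _)).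
by apply: eq_bigr => a _; rewrite /bump /= add1n addSnnS.
Qed.

End DecreasingSequences.

Section DecrTuples.
Variable k : nat.

(** The double [insub] reflects a subtype of a subtype; it never fails on [decr_seqs], as
    [map_decr_tuples] shows. *)
Definition decr_of (u : seq nat) : option (decr_tuple k) :=
  if insub u : option (k.-tuple nat) is Some t then insub t else None.

Definition decr_tuples n : seq (decr_tuple k) := pmap decr_of (decr_seqs k n).

Lemma map_decr_tuples n : map (fun t => val (val t)) (decr_tuples n) = decr_seqs k n.
Proof.
have : all (fun u => (size u == k) && sorted geq u) (decr_seqs k n).
  by apply/allP => u; rewrite mem_decr_seqs => /andP[-> /path_sorted].
rewrite /decr_tuples; elim: (decr_seqs k n) => // u s IH /andP[/andP[uk us] /IH {}IH].
have [t tu uE] : exists2 t, decr_of u = Some t & val (val t) = u.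
  rewrite /decr_of; case: insubP => [t _ tu|]; last by rewrite uk.
  case: insubP => [t' _ t'u|]; first by exists t'; rewrite // t'u.
  by rewrite tu us.
by rewrite /= tu /= uE IH.
Qed.

Lemma decr_tuples_uniq n : uniq (decr_tuples n).
Proof.
apply: (@map_uniq _ _ (fun t => val (val t))).
by rewrite map_decr_tuples decr_seqs_uniq.
Qed.

Lemma mem_decr_tuples n (t : decr_tuple k) : (t \in decr_tuples n) = path geq n (val (val t)).
Proof.
rewrite -(mem_map (f := fun t : decr_tuple k => val (val t))); last first.
  by move=> t1 t2 /val_inj /val_inj.
by rewrite map_decr_tuples mem_decr_seqs size_tuple eqxx.
Qed.

Lemma sum_decr_tuples (V : nmodType) (f : seq nat -> V) n :
  \sum_(t <- decr_tuples n) f (val (val t)) = \sum_(u <- decr_seqs k n) f u.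
Proof. by rewrite -(map_decr_tuples n) big_map. Qed.

End DecrTuples.

Lemma exprzN_odd (F : fieldType) (x : F) (n m : int) : n = 2 * m + 1 -> x != 0 ->
  (- x) ^ n = - x ^ n.
Proof.
move=> -> x0; rewrite !expfzDr ?oppr_eq0 // -!exprz_exp !expr1z mulrN.
by congr (- (_ ^ m * _)); rewrite -!exprnP sqrrN.
Qed.

Lemma eq_path_weight (F : fieldType) (g g' : nat -> nat -> nat -> F) (e : nat -> F) i n t :
  (forall i' n' s, (i <= i')%N -> g i' n' s = g' i' n' s) ->
  path_weight g e i n t = path_weight g' e i n t.
Proof.
elim: t i n => //= s t IH i n gg; rewrite gg // IH // => i' n' s' ii'.
by apply: gg; exact: ltnW.
Qed.

(** * The multiple sum for nonzero q = - x *)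

Section Main.
Variables (R : realType) (K : numFieldType) (nm : K -> R) (nmP : absval nm).
Variables (x : K) (k r j : nat) (I : seq nat).
Hypothesis x1 : nm x < 1.
Hypothesis x0 : x != 0.
Hypothesis hk : (1 <= k)%N.
Hypothesis hjr : (j + r <= k)%N.
Hypothesis uI : uniq I.
Hypothesis sI : size I = j.
Hypothesis hI : all (fun i => 1 <= i <= k - r)%N I.

Local Notation Q := (x ^+ 2).
Local Notation b := (x ^+ (2 * k + 2)).
Let Y (e : int) (s : nat) := x ^ (e + 2 * j%:Z - 4 * s%:Z).

Let xx1 := one_sub_exp_neq0 nmP x1.

Let Q1 : nm Q < 1.
Proof. exact: (nm_expS_lt1 nmP x1 1). Qed.

Let QQ1 := one_sub_exp_neq0 nmP Q1.

Let Q0 : Q != 0. Proof. by rewrite expf_neq0. Qed.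

Lemma nm_exprz_lt1 (n : int) : 0 < n -> nm (x ^ n) < 1.
Proof. by case: n => [[|n]|n] // _; rewrite -exprnP; exact: nm_expS_lt1. Qed.

(** The bound j + r <= k makes all these exponents of x positive, the least being 2 k + 1 - 2 r - 2
    j. *)
Lemma theta_param (e : int) s : (s <= j)%N -> e = 1 - 2 * r%:Z \/ e = - 1 - 2 * r%:Z ->
  nm (b * Y e s) < 1 /\ nm (b / Y e s) < 1.
Proof.
move=> sj he; rewrite exprnP /Y invr_expz -!expfzDr //.
by split; apply: nm_exprz_lt1; case: he => ->; lia.
Qed.

(** At the end of the chain [alpha_final] splits beta into 2 (j + 1) theta series summed against the
    kernel, each with the limit given by [theta_bailey_cvg]. *)
Lemma nested_sum_cvg : nested_sum x k r I k 1 @ \oo -->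
  \sum_(s < j.+1) 'C(j, s)%:R *
     (theta_inf b (Y (1 - 2 * r%:Z) s) - x * theta_inf b (Y (- 1 - 2 * r%:Z) s))
     / qpoch_inf Q Q ^+ 2.
Proof.
have rk : (r <= k)%N by lia.
have pair := nested_sum_pair0 xx1 x0 rk uI hI (leqnn (k - r)).
rewrite subnn subnKC // in pair.
have cnt : count (fun i => 0 < i)%N I = j.
  by rewrite -sI; apply/eqP; rewrite -all_count; apply: sub_all hI => i /andP[].
pose B e s n := \sum_(l < n.+1) theta_coef b (Y e s) l * bailey_ker Q 0 n l.
have -> : nested_sum x k r I k 1 = (fun n => \sum_(s < j.+1) 'C(j, s)%:R *
    (B (1 - 2 * r%:Z) s n - x * B (- 1 - 2 * r%:Z) s n)).
  apply/funext => n; rewrite pair cnt.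
  under eq_bigr => l _.
    rewrite (alpha_final x0 rk); over.
  rewrite /= /B; under eq_bigr do rewrite mulr_suml.
  rewrite exchange_big /=; apply: eq_bigr => s _.
  rewrite mulr_sumr -sumrB mulr_sumr; apply: eq_bigr => l _; rewrite /Y; ring.
have cvB e s : (s <= j)%N -> e = 1 - 2 * r%:Z \/ e = - 1 - 2 * r%:Z ->
    B e s @ \oo --> theta_inf b (Y e s) / qpoch_inf Q Q ^+ 2.
  move=> sj /(theta_param sj)[h1 h2].
  by apply: (theta_bailey_cvg nmP _ _ h1 h2 Q1); rewrite ?expf_neq0 ?expfz_neq0.
apply: cvg_big => [|s _]; first exact: add_continuous.
have sj : (s <= j)%N by rewrite -ltnS.
rewrite -mulrA; apply: cvgM; first exact: cvg_cst.
rewrite mulrBl -mulrA; apply: cvgB; first by apply: cvB => //; left.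
by apply: cvgM; [exact: cvg_cst|apply: cvB => //; right].
Qed.

Local Notation W := (weight x k r I).
Local Notation e := (fun n => (1 - x) / qprod x x n.*2).

(** The weight after s_0 -> oo, which affects the index 1 only: there Q^n tends to 0 and (Q;
    Q)_(n-s) to (Q; Q)_oo. *)
Definition weight_lim i n s : K :=
  if i == 1%N then
    Q ^+ (s * s + (if (k - r < i)%N then s else 0%N)) *
    (if i \in I then Q ^- s else 1) / qpoch_inf Q Q
  else W i n s.

(** The argument 0 holds the place of s_0, which [weight_lim] has already sent to infinity. *)
Let g (t : decr_tuple k) : K := path_weight weight_lim e 1 0 (val (val t)).

Lemma expr_cvg0 : (fun n => Q ^+ n) @ \oo --> (0 : K).
Proof.
apply/(nm_cvg nmP) => d d0.
have := @cvg_geometric R 1 (nm Q); rewrite ger0_norm ?(nm_ge0 nmP) // => /(_ Q1).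
move=> /cvgrPdist_le /(_ _ d0); apply: filterS => n /=.
by rewrite !sub0r normrN mul1r (nmN nmP) (nmX nmP Q) ger0_norm ?exprn_ge0 ?(nm_ge0 nmP).
Qed.

Lemma path_weight_cvg t : (fun n => path_weight W e 1 n (val (val t))) @ \oo --> g t.
Proof.
rewrite /g; move tE : (val (val t)) => v.
have : size v = k by rewrite -tE size_tuple.
case: v {tE} => [|s u] /= vk; first by move: hk; rewrite -vk.
have -> : path_weight weight_lim e 2 s u = path_weight W e 2 s u.
  by apply: eq_path_weight => -[|[]].
apply: cvgM; last exact: cvg_cst.
rewrite /weight_lim eqxx /weight; apply: cvgM.
  apply: cvgM; first exact: cvg_cst.
  case: (1%N \in I); last exact: cvg_cst.
  have : (fun n => Q ^+ n + Q ^- s) @ \oo --> 0 + Q ^- s.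
    by apply: cvgD; [exact: expr_cvg0|exact: cvg_cst].
  by rewrite add0r.
rewrite -(cvg_shiftn s); under eq_fun do rewrite addnK.
exact: (qfV_cvg nmP Q1).
Qed.

(** The additional factor may reach 2 |Q|^(-s), but s^2 >= 2 s - 1 still leaves |Q|^s / |Q|. The
    bound is uniform in n, as dominated convergence requires. *)
Lemma weight_bound : exists2 D, 0 <= D & forall i n s, nm (W i n s) <= D * nm Q ^+ s.
Proof.
have [C C0 qfC] := qfV_bound nmP Q1.
have rho0 := nm_gt0 nmP Q0; have rho1 := ltW Q1.
have rhoX n : 0 <= nm Q ^+ n <= 1 by rewrite exprn_ge0 ?exprn_ile1 // ltW.
exists (2 * C / nm Q); first by rewrite divr_ge0 ?mulr_ge0 // ltW.
move=> i n s; rewrite /weight (nmM nmP) (nmM nmP (Q ^+ _)) (nmX nmP Q).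
have h1 : nm (if i \in I then Q ^+ n + Q ^- s else 1) <= 2 / nm Q ^+ s.
  have s1 : 1 <= (nm Q ^+ s)^-1.
    by rewrite invf_ge1 ?exprn_gt0 //; case/andP: (rhoX s).
  case: ifP => _; last by rewrite (nm1 nmP); lra.
  apply: (le_trans (nmD nmP _ _)); rewrite (nmV nmP) !(nmX nmP Q).
  by case/andP: (rhoX n); lra.
have h2 : nm Q ^+ (s * s + (if (k - r < i)%N then s else 0%N)) <= nm Q ^+ s * nm Q ^+ s / nm Q.
  rewrite ler_pdivlMr // -exprSr -exprD; apply: ler_wiXn2l; rewrite ?(nm_ge0 nmP) //.
  have ss : (s + s <= (s * s).+1)%N.
    by rewrite addnn -mul2n; case: (s) => [|[|m]] //; rewrite leqW // leq_mul2r.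
  by apply: (leq_trans ss); rewrite ltnS leq_addr.
have e0 : 0 <= nm Q ^+ (s * s + (if (k - r < i)%N then s else 0%N)) by rewrite exprn_ge0 // ltW.
have h := ler_pM (mulr_ge0 e0 (nm_ge0 nmP _)) (nm_ge0 nmP _)
                 (ler_pM e0 (nm_ge0 nmP _) h2 h1) (qfC (n - s)%N).
apply: (le_trans h); rewrite le_eqVlt; apply/orP; left; apply/eqP.
by field; rewrite expf_neq0 ?lt0r_neq0.
Qed.

(** Dominated convergence over the tuples with s_1 <= n. The majorant is a product of geometric
    terms D |Q|^(s_i), so summing layer by layer bounds its total by E (D / (1 - |Q|))^k. *)
Lemma sums_to_path_weight L : nested_sum x k r I k 1 @ \oo --> L -> sums_to g L.
Proof.
move=> cvL.
have [D D0 WD] := weight_bound.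
have [C C0 xC] := qfV_bound nmP x1.
have rho0 := nm_ge0 nmP Q.
pose E := nm (1 - x) * C.
have E0 : 0 <= E by rewrite mulr_ge0 ?(nm_ge0 nmP) // ltW.
pose M (u : seq nat) := E * \prod_(s <- u) (D * nm Q ^+ s).
have M0 u : 0 <= M u.
  by rewrite mulr_ge0 // prodr_ge0 // => s _; rewrite mulr_ge0 // exprn_ge0.
have path_weightM i n u : nm (path_weight W e i n u) <= M u.
  elim: u i n => [|s u IH] i n /=.
    by rewrite /M big_nil mulr1 (nmM nmP); apply: ler_pM; rewrite ?(nm_ge0 nmP) ?xC.
  by rewrite /M big_cons mulrCA (nmM nmP); apply: ler_pM; rewrite ?(nm_ge0 nmP) //.
have sumM m n : \sum_(u <- decr_seqs m n) M u <= E * (D / (1 - nm Q)) ^+ m.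
  elim: m n => [|m IH] n; first by rewrite big_seq1 /M big_nil expr0.
  rewrite (_ : decr_seqs m.+1 n = [seq s :: t | s <- index_iota 0 n.+1, t <- decr_seqs m s]) //.
  rewrite big_allpairs_dep big_mkord.
  apply: (@le_trans _ _ (\sum_(s < n.+1) D * nm Q ^+ s * (E * (D / (1 - nm Q)) ^+ m))).
    apply: ler_sum => s _.
    have -> : \sum_(u <- decr_seqs m s) M ((s : nat) :: u) =
        D * nm Q ^+ s * \sum_(u <- decr_seqs m s) M u.
      by rewrite mulr_sumr; apply: eq_bigr => u _; rewrite /M big_cons mulrCA.
    by apply: ler_wpM2l; rewrite // mulr_ge0 // exprn_ge0.
  rewrite -mulr_suml -mulr_sumr [_ ^+ m.+1]exprSr [leRHS]mulrA [leLHS]mulrC.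
  have d1 : 0 < 1 - nm Q by rewrite subr_gt0.
  apply: ler_wpM2l; first by rewrite mulr_ge0 // exprn_ge0 // divr_ge0 // ltW.
  apply: ler_wpM2l => //; rewrite -[leRHS]mul1r ler_pdivlMr //.
  exact: geo_sum_le.
apply: (tannery_sums_to nmP (f := fun n t => path_weight W e 1 n (val (val t)))
  (M := fun t => M (val (val t))) (A := decr_tuples k)
  (C := E * (D / (1 - nm Q)) ^+ k)) => //.
- exact: decr_tuples_uniq.
- move=> t; have : sorted geq (val (val t)) := valP t.
  case tE : (val (val t)) => [|s u] /= su; last first.
    by exists s => // n /= sn; rewrite mem_decr_tuples tE /= su andbT.
  by exists 0%N => // n _ /=; rewrite mem_decr_tuples tE.
- by move=> n; rewrite (sum_decr_tuples k M n).
- exact: path_weight_cvg.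
- rewrite (_ : (fun n => _) = nested_sum x k r I k 1) //; apply/funext => n.
  by rewrite (sum_decr_tuples k (path_weight W e 1 n) n) sum_path_weight.
Qed.

(** At q = - x the entries of odd exponent become - b Y and - b / Y, the parameters of [theta_inf],
    and the coefficient q becomes - x. The powers of (Q; Q)_oo are arranged to match
    [nested_sum_cvg]. *)
Lemma rhsE : rhs (- x) k r j =
  qpoch_inf (x ^+ 3) Q * qpoch_inf Q Q *
  \sum_(s < j.+1) 'C(j, s)%:R *
     (theta_inf b (Y (1 - 2 * r%:Z) s) - x * theta_inf b (Y (- 1 - 2 * r%:Z) s))
     / qpoch_inf Q Q ^+ 2.
Proof.
have Qn0 := qpoch_inf_q_neq0 nmP Q1.
rewrite /rhs -mulr_suml sqrrN big_mkord.
have -> : - (- x) ^+ 3 = x ^+ 3 by rewrite exprNn -signr_odd /= expr1 mulN1r opprK.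
have baseE : (- x) ^+ (4 * k + 4) = b ^+ 2.
  rewrite -exprM (_ : 4 * k + 4 = 2 * ((2 * k + 2)))%N; last by lia.
  by rewrite exprM sqrrN -exprM mulnC.
have baseZ : (- x) ^ (4 * k%:Z + 4) = b ^+ 2 by rewrite -baseE exprnP.
rewrite [RHS](_ : _ = qpoch_inf (x ^+ 3) Q / qpoch_inf Q Q * \sum_(s < j.+1) 'C(j, s)%:R *
     (theta_inf b (Y (1 - 2 * r%:Z) s) - x * theta_inf b (Y (- 1 - 2 * r%:Z) s))); last first.
  by field.
congr (_ * _); apply: eq_bigr => s _; congr (_ * _).
have byE (n e : int) : n = 2 * k%:Z + 2 + (e + 2 * j%:Z - 4 * s%:Z) ->
    (exists m, e = 2 * m + 1) -> (- x) ^ n = - (b * Y e s).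
  move=> -> [m em]; rewrite (@exprzN_odd _ _ _ (k%:Z + 1 + m + j%:Z - 2 * s%:Z)) //; last by lia.
  by congr (- _); rewrite exprnP /Y -expfzDr.
have bzE (n e : int) : n = 2 * k%:Z + 2 - (e + 2 * j%:Z - 4 * s%:Z) ->
    (exists m, e = 2 * m + 1) -> (- x) ^ n = - (b / Y e s).
  move=> -> [m em]; rewrite (@exprzN_odd _ _ _ (k%:Z - m - j%:Z + 2 * s%:Z)) //; last by lia.
  by congr (- _); rewrite exprnP /Y invr_expz -expfzDr.
have o1 : exists m, 1 - 2 * r%:Z = 2 * m + 1 by exists (- r%:Z); lia.
have o2 : exists m, - 1 - 2 * r%:Z = 2 * m + 1 by exists (- 1 - r%:Z); lia.
rewrite mulNr baseZ baseE /theta_inf.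
by congr (qpochs_inf [:: _; _; _] _ - _ * qpochs_inf [:: _; _; _] _);
  (apply: byE || apply: bzE) => //; lia.
Qed.

(** The tail (x Q^(s_k); Q)_oo is (x; Q)_oo / (x; Q)_(s_k); with 1 / (Q; Q)_(s_k) it produces 1 /
    (x; x)_(2 s_k). The constant (Q; Q)_oo cancels the denominator left at index 1 by s_0 -> oo. *)
Lemma lhs_termE (t : decr_tuple k) :
  lhs_term (- x) k r (\prod_(i <- I) P_factor (- x) i (part t)) (part t) =
  qpoch_inf (x ^+ 3) Q * qpoch_inf Q Q * g t.
Proof.
have Qn0 := qpoch_inf_q_neq0 nmP Q1.
pose p := part t.
(* The denominator of index i is that of s_(i-1) - s_i; index 1 carries the limit for s_0 -> oo. *)
pose den i := if i == 1%N then qpoch_inf Q Q else qprod Q Q (p i.-1 - p i).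
pose ex i := (p i * p i + (if (k - r < i)%N then p i else 0))%N.
have gE : g t = (\prod_(1 <= i < k.+1) (Q ^+ ex i *
   (if i \in I then P_factor (- x) i p else 1) / den i)) * e (p k).
  rewrite /g path_weight_prod size_tuple big_add1 big_mkord; congr (_ * _); last first.
    by rewrite -nth_last size_tuple /p /part.
  apply: eq_bigr => a _; rewrite add1n /weight_lim /den /ex /P_factor /p /part.
  case: (nat_of_ord a) => [|a'] /=; first by rewrite exprM sqrrN.
  by rewrite /weight !exprM sqrrN.
have powE : (- x) ^+ (2 * (\sum_(1 <= i < k.+1) p i ^ 2 + \sum_(k - r + 1 <= i < k.+1) p i)) =
   \prod_(1 <= i < k.+1) Q ^+ ex i.
  rewrite exprM sqrrN -expr_sum; congr (_ ^+ _); rewrite big_split /=; congr (_ + _)%N.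
  rewrite (@big_nat_widenl _ _ _ (k - r + 1) 1) ?addn1 //= big_mkcond /=.
  by apply: eq_bigr => i _.
have facE : \prod_(i <- I) P_factor (- x) i p =
   \prod_(1 <= i < k.+1) (if i \in I then P_factor (- x) i p else 1).
  rewrite -big_mkcond -[RHS]big_filter; apply: perm_big; apply: uniq_perm.
  - exact: uI.
  - by rewrite filter_uniq // iota_uniq.
  - move=> i; rewrite mem_filter mem_index_iota; case: (boolP (i \in I)) => //= /(allP hI); lia.
have denE : \prod_(1 <= i < k.+1) den i =
   qpoch_inf Q Q * \prod_(1 <= i < k) qpoch Q Q (p i - p i.+1).
  rewrite big_ltn ?ltnS // big_add1 /=; congr (_ * _); rewrite !big_nat.
  apply: eq_bigr => i /andP[i1 _]; rewrite /den (qpoch_qE nmP Q1).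
  by case: i i1.
have tailE : qpoch_inf (- (- x) ^+ (1 + 2 * p k)) Q =
    qpoch_inf (x ^+ 3) Q * (1 - x) / qprod x Q (p k).
  have -> : - (- x) ^+ (1 + 2 * p k) = x * Q ^+ p k.
    by rewrite add1n exprS exprM sqrrN mulNr opprK.
  have := qpoch_inf_shift nmP Q1 x (p k); rewrite (qpoch_inf_shift nmP Q1 x 1).
  rewrite expr1 -exprS qprodS qprod0 mul1r expr0 mulr1 => h.
  rewrite [X in _ = X / _]mulrC h mulrAC mulfV ?mul1r //; apply/prodf_neq0 => i _.
  by rewrite -exprM -exprS.
rewrite /lhs_term -/p sqrrN powE facE tailE gE (qpoch_qE nmP Q1).
rewrite [in RHS]big_split [in RHS]big_split /= prodfV denE qprod_double.
set A := \prod_(1 <= i < k.+1) _; set B := \prod_(1 <= i < k.+1) _.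
have D0 : \prod_(1 <= i < k) qpoch Q Q (p i - p i.+1) != 0.
  by rewrite prodf_seq_neq0; apply/allP => i _; rewrite /= (qpoch_qE nmP Q1) qf_neq0.
have x20 : qprod x Q (p k) != 0.
  by apply/prodf_neq0 => i _; rewrite -exprM -exprS.
by field; rewrite Qn0 D0 x20 qf_neq0.
Qed.

Lemma sums_to_lhs :
  sums_to (fun t : decr_tuple k =>
     lhs_term (- x) k r (\prod_(i <- I) P_factor (- x) i (part t)) (part t))
    (rhs (- x) k r j).
Proof.
rewrite rhsE; apply: eq_sums_to (sums_toZ (sums_to_path_weight nested_sum_cvg)) => t.
by rewrite lhs_termE.
Qed.

End Main.

(** * The case q = 0 *)

Section ZeroCase.
Variables (K : numFieldType) (k r : nat).
Hypothesis hk : (1 <= k)%N.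
Hypothesis hr : (r <= k)%N.

Lemma qpoch_inf0 (q : K) : qpoch_inf 0 q = 1.
Proof.
rewrite /qpoch_inf; under eq_fun do under eq_bigr do rewrite mul0r subr0.
under eq_fun do rewrite big1_eq.
by apply: (@cvg_lim K) => //; exact: cvg_cst.
Qed.

Lemma qpoch0 (n : nat) : qpoch (0 : K) 0 n = 1.
Proof. by rewrite /qpoch mul0r qpoch_inf0 divr1. Qed.

Lemma rhs0 : rhs (0 : K) k r 0 = 1.
Proof.
have exp0 (n : int) : 0 < n -> (0 : K) ^ n = 0.
  by move=> n0; rewrite exp0rz gt_eqF.
rewrite /rhs big_nat1 bin0 mul1r mul0r addr0 !expr0n /= oppr0 addn4 /= !exp0; try by lia.
by rewrite /qpochs_inf !big_cons big_nil !qpoch_inf0 !mulr1 divr1.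
Qed.

Lemma sorted_nseq0 m : sorted geq (nseq m 0%N).
Proof. by case: m => //= m; elim: m. Qed.

Definition zero_decr : decr_tuple k := exist _ [tuple of nseq k 0%N] (sorted_nseq0 k).

(** As 0^0 = 1, only the exponent 0 survives; it contains the sum of the s_i^2, so every s_i is
    0. *)
Lemma lhs_term0 (t : decr_tuple k) :
  lhs_term (0 : K) k r 1 (part t) = (t == zero_decr)%:R.
Proof.
rewrite /lhs_term mulr1 !expr0n /= ?mulr0n oppr0 qpoch_inf0 qpoch0.
rewrite [\prod_(1 <= i < k) _]big1 => [|i _]; last exact: qpoch0.
rewrite !mulr1 divr1 muln_eq0 /= addn_eq0 !sum_nat_seq_eq0.
congr ((nat_of_bool _)%:R); apply/idP/eqP => [/andP[/allP p0 _]|->].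
  do 2!apply: val_inj; apply: (@eq_from_nth _ 0%N); rewrite ?size_tuple // => a ak.
  have am : a.+1 \in index_iota 1 k.+1 by rewrite mem_index_iota.
  have /= := p0 _ am; rewrite expn_eq0 andbT => /eqP.
  by rewrite /part /= nth_nseq if_same.
by rewrite /part /=; apply/andP; split; apply/allP => i _ /=; rewrite nth_nseq if_same.
Qed.

Lemma sums_to_lhs0 :
  sums_to (fun t : decr_tuple k => lhs_term (0 : K) k r 1 (part t)) (rhs 0 k r 0).
Proof.
rewrite rhs0; apply: cvg_near_cst; exists [fset zero_decr]%fset => // J /= zJ.
rewrite /= partial_sumE.
rewrite (bigD1_seq zero_decr) ?fset_uniq //=; last by rewrite (fsubsetP zJ) // inE.
rewrite lhs_term0 eqxx big1 ?addr0 // => t /negbTE tz.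
by rewrite lhs_term0 tz.
Qed.

End ZeroCase.

(** This makes the identity for P_j the case I = {1, ..., j} of the general one. *)
Lemma P_prodE (K : numFieldType) (q : K) j s :
  P_ q j s = \prod_(i <- iota 1 j) P_factor q i s.
Proof.
rewrite /P_; case: j => [|j]; first by rewrite /= big_nil.
rewrite [iota _ _]/= big_cons /= /P_factor eqxx; congr (_ * _).
rewrite (_ : iota 2 j = index_iota 2 j.+2); last by rewrite /index_iota subn2.
by rewrite !big_nat; apply: eq_bigr => -[|[|i]].
Qed.

Lemma sums_to_multisum (R : realType) (K : numFieldType) (nm : K -> R) (q : K)
    (j r k : nat) (I : seq nat) : absval nm ->
  nm q < 1 -> ((0 < j)%N -> q != 0) -> (1 <= k)%N -> (j + r <= k)%N ->
  uniq I -> size I = j -> all (fun i => 1 <= i <= k - r)%N I ->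
  sums_to (fun t : decr_tuple k =>
     lhs_term q k r (\prod_(i <- I) P_factor q i (part t)) (part t))
    (rhs q k r j).
Proof.
move=> nmP q1 qj hk hjr uI sI hI; have [q0|q0] := eqVneq q 0.
  have j0 : j = 0%N by case: j qj {hjr sI} => // j /(_ isT); rewrite q0 eqxx.
  move: hjr sI; rewrite q0 j0 add0n => hr /size0nil ->.
  by apply: (eq_sums_to _ (sums_to_lhs0 (K := K) hk hr)) => t; rewrite big_nil.
rewrite -[q]opprK; apply: (sums_to_lhs nmP) => //.
- by rewrite (nmN nmP).
- by rewrite oppr_eq0.
Qed.

Local Open Scope complex_scope.

(* The only negative powers of q are in P_j, hence q = 0 is excluded exactly
   when j >= 1. *)
Theorem theorem1p11 (R : realType) (q : R[i]) (j r k : nat)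
    (hq : `|q| < 1) (hq0 : (0 < j)%N -> q != 0)
    (hk : (1 <= k)%N) (hjr : (j + r <= k)%N) :
  sums_to (fun t : decr_tuple k => lhs_term q k r (P_ q j (part t)) (part t))
          (rhs q k r j)
  /\
  (forall I : seq nat, uniq I -> size I = j ->
     all (fun i => 1 <= i <= k - r)%N I ->
     sums_to (fun t : decr_tuple k =>
                lhs_term q k r (\prod_(i <- I) P_factor q i (part t)) (part t))
             (rhs q k r j)).
Proof.
have q1 : ComplexField.Normc.normc q < 1 by move: hq; rewrite -ltcR.
have main I : uniq I -> size I = j -> all (fun i => 1 <= i <= k - r)%N I -> _ :=
  sums_to_multisum (normc_absval R) q1 hq0 hk hjr.
split=> //; apply: (eq_sums_to (f := fun t : decr_tuple k =>
  lhs_term q k r (\prod_(i <- iota 1 j) P_factor q i (part t)) (part t))).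
  by move=> t; rewrite P_prodE.
apply: main; rewrite ?iota_uniq ?size_iota //.
by apply/allP => i; rewrite mem_iota; lia.
Qed.
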